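(* Suppose $U$ satisfies Assumption (U) and $G$ satisfies Assumption (G1) (see context). 1. (Multi-particle.) Let $N\ge2$. For $(\mathbf{q}_0,\mathbf{p}_0)\in\mathbf{X}$ let $(\mathbf{q}^\varepsilon(t),\mathbf{p}^\varepsilon(t))$ solve the relativistic system and $(\mathbf{q}(t),\mathbf{p}(t))$ solve the Langevin system (see context), both started at $(\mathbf{q}_0,\mathbf{p}_0)$ and driven by the same Brownian motions. Then for all $T>0$ and $\xi>0$, $$\mathbb{P}\Big(\sup_{t\in[0,T]}\big[|\mathbf{q}^\varepsilon(t)-\mathbf{q}(t)|+|\mathbf{p}^\varepsilon(t)-\mathbf{p}(t)|\big]>\xi\Big)\to0\quad\text{as }\varepsilon\to0.$$ 2. (Single-particle.) Let $N=1$. For $(q_0,p_0)\in(\mathbb{R}^d\setminus\{0\})\times\mathbb{R}^d$ let $(q^\varepsilon,p^\varepsilon)$ and $(q,p)$ solve the single-particle relativistic and Langevin systems (see context) with initial condition $(q_0,p_0)$ and the same Brownian motion. Then for all $T>0$ and $n\ge1$, $$\mathbb{E}\sup_{t\in[0,T]}\big[|q^\varepsilon(t)-q(t)|^n+|p^\varepsilon(t)-p(t)|^n\big]\to0\quad\text{as }\varepsilon\to0.$$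
   Context: Assumption (U): $U\in C^\infty(\mathbb{R}^d;[1,\infty))$ and there are constants $a_1>0$, $\lambda\ge 1$, $a_2,a_3>0$ such that for all $q$: $\frac{1}{a_1}|q|^{\lambda+1}-a_1\le |U(q)|\le a_1(1+|q|^{\lambda+1})$, $|\nabla U(q)|\le a_1(1+|q|^\lambda)$, $\langle\nabla U(q),q\rangle\ge a_2|q|^{\lambda+1}-a_3$. Assumption (G1): $G\in C^\infty(\mathbb{R}^d\setminus\{0\};\mathbb{R})$, $G(q)\to\infty$ as $|q|\to0$, $G$ even, $\nabla G$ odd; there is $\beta_1\ge1$ with $|G(q)|\le a_1(1+|q|+|q|^{-\beta_1})$, $|\nabla G(q)|\le a_1(1+|q|^{-\beta_1})$; and constants $\beta_2\in[0,\beta_1)$, $a_4>0$, $a_5\in\mathbb{R}$, $a_6>0$ with $\big|\nabla G(q)+a_4\frac{q}{|q|^{\beta_1+1}}+a_5\frac{q}{|q|^{\beta_2+1}}\big|\le a_6$ for $q\ne0$. For $N\ge2$: $\mathcal{D}=\{\mathbf{q}\in(\mathbb{R}^d)^N:q_i\ne q_j\ (i\ne j)\}$, $\mathbf{X}=\mathcal{D}\times(\mathbb{R}^d)^N$; $W_1,\dots,W_N$ i.i.d. standard $d$-dimensional Brownian motions. Relativistic system ($\varepsilon\in(0,1)$): $dq_i=\frac{p_i}{\sqrt{1+\varepsilon|p_i|^2}}dt$, $dp_i=-\frac{p_i}{\sqrt{1+\varepsilon|p_i|^2}}dt-\nabla U(q_i)dt-\sum_{j\ne i}\nabla G(q_i-q_j)dt+\sqrt2\,dW_i$.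 Langevin system: $dq_i=p_i\,dt$, $dp_i=-p_i\,dt-\nabla U(q_i)dt-\sum_{j\ne i}\nabla G(q_i-q_j)dt+\sqrt2\,dW_i$. For $N=1$: relativistic system $dq=\frac{p}{\sqrt{1+\varepsilon|p|^2}}dt$, $dp=-\frac{p}{\sqrt{1+\varepsilon|p|^2}}dt-\nabla U(q)dt-\nabla G(q)dt+\sqrt2\,dW$; Langevin system $dq=p\,dt$, $dp=-p\,dt-\nabla U(q)dt-\nabla G(q)dt+\sqrt2\,dW$. *)

(* Defs.v *)
From HB Require Import structures.
From mathcomp Require Import all_boot all_order all_algebra.
From mathcomp Require Import all_classical all_reals all_analysis.
Set Implicit Arguments. Unset Strict Implicit. Unset Printing Implicit Defensive.
Import Order.TTheory GRing.Theory Num.Theory.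
Import numFieldNormedType.Exports.
Local Open Scope classical_set_scope.
Local Open Scope ring_scope.

Section Defs.
Variable R : realType.

(* A point of R^d is a row vector 'rV[R]_d = 'M[R]_(1,d); a configuration of
   n particles in R^d is a matrix 'M[R]_(n,d) whose i-th row is particle i. *)

Definition dotv (d : nat) (u v : 'rV[R]_d) : R := \sum_(k < d) u 0 k * v 0 k.

Definition enorm (n d : nat) (M : 'M[R]_(n, d)) : R :=
  Num.sqrt (\sum_(i < n) \sum_(k < d) M i k ^+ 2).

Fixpoint Ck_on (k : nat) (d : nat) (A : set 'rV[R]_d) (f : 'rV[R]_d -> R)
  : Prop :=
  match k with
  | 0 => forall x, A x -> {for x, continuous f}
  | k'.+1 => (forall x, A x -> differentiable f x) /\
             (forall v : 'rV[R]_d, Ck_on k' A (fun x => 'd f x v))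
  end.

Definition smooth_on (d : nat) (A : set 'rV[R]_d) (f : 'rV[R]_d -> R) :=
  forall k, Ck_on k A f.

Definition grad (d : nat) (f : 'rV[R]_d -> R) (x : 'rV[R]_d) : 'rV[R]_d :=
  \row_(i < d) 'd f x (delta_mx 0 i).

Definition AssumptionU (d : nat) (U : 'rV[R]_d -> R) : Prop :=
  smooth_on setT U /\ (forall q, 1 <= U q) /\
  exists a1 lam a2 a3 : R, [/\ 0 < a1, 1 <= lam, 0 < a2, 0 < a3 &
    forall q : 'rV[R]_d,
      [/\ a1^-1 * enorm q `^ (lam + 1) - a1 <= `|U q|,
          `|U q| <= a1 * (1 + enorm q `^ (lam + 1)),
          enorm (grad U q) <= a1 * (1 + enorm q `^ lam) &
          a2 * enorm q `^ (lam + 1) - a3 <= dotv (grad U q) q]].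

Definition AssumptionG1 (d : nat) (G : 'rV[R]_d -> R) : Prop :=
  [/\ smooth_on (~` [set 0]) G,
      (forall M : R, \forall x \near (0 : 'rV[R]_d)^', M < G x),
      (forall q, G (- q) = G q),
      (forall q, q != 0 -> grad G (- q) = - grad G q) &
  exists a1 b1 b2 a4 a5 a6 : R,
    [/\ 0 < a1 /\ 1 <= b1, 0 <= b2 /\ b2 < b1, 0 < a4, 0 < a6 &
    forall q : 'rV[R]_d, q != 0 ->
      [/\ `|G q| <= a1 * (1 + enorm q + enorm q `^ (- b1)),
          enorm (grad G q) <= a1 * (1 + enorm q `^ (- b1)) &
          enorm (grad G q + (a4 / enorm q `^ (b1 + 1)) *: q
                          + (a5 / enorm q `^ (b2 + 1)) *: q) <= a6]]].

Definition relvel (eps : R) (d : nat) (p : 'rV[R]_d) : 'rV[R]_d :=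
  (Num.sqrt (1 + eps * enorm p ^+ 2))^-1 *: p.
Definition langvel (d : nat) (p : 'rV[R]_d) : 'rV[R]_d := p.

Definition forceN (N d : nat) (U G : 'rV[R]_d -> R) (q : 'M[R]_(N, d))
  : 'M[R]_(N, d) :=
  \matrix_(i < N, k < d)
    (grad U (row i q) + \sum_(j < N | j != i) grad G (row i q - row j q)) 0 k.

Definition force1 (d : nat) (U G : 'rV[R]_d -> R) (q : 'rV[R]_d) : 'rV[R]_d :=
  grad U q + grad G q.

Definition noncoll (N d : nat) : set 'M[R]_(N, d) :=
  [set q | forall i j : 'I_N, i != j -> row i q != row j q].

(* A pathwise (global, t >= 0) solution, in integral form, of
     dq_i = v(p_i) dt,  dp_i = -v(p_i) dt - F(q)_i dt + sqrt 2 dW_i,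
   staying in the domain D, with continuous paths, started at (q0,p0),
   driven by the path w (w 0 = 0). *)
Definition is_solution (n d : nat) (v : 'rV[R]_d -> 'rV[R]_d)
  (F : 'M[R]_(n, d) -> 'M[R]_(n, d)) (D : set 'M[R]_(n, d))
  (q0 p0 : 'M[R]_(n, d)) (w q p : R -> 'M[R]_(n, d)) : Prop :=
  [/\ (forall t, 0 <= t -> D (q t)),
      {within `[0, +oo[, continuous q},
      {within `[0, +oo[, continuous p} &
      forall t, 0 <= t -> forall (i : 'I_n) (k : 'I_d),
        q t i k = q0 i k
          + (\int[lebesgue_measure]_(s in `[0, t]) (v (row i (p s)) 0 k))
        /\
        p t i k = p0 i k
          + (\int[lebesgue_measure]_(s in `[0, t])
                 (- v (row i (p s)) 0 k - F (q s) i k))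
          + Num.sqrt 2 * w t i k].

Section Prob.
Context {dO : measure_display} {Omega : measurableType dO}.
Variable P : probability Omega R.

Definition mutually_independent (I : finType) (X : I -> Omega -> R) : Prop :=
  (forall i, measurable_fun setT (X i)) /\
  forall B : I -> set R, (forall i, measurable (B i)) ->
    P (\bigcap_(i in [set: I]) (X i @^-1` B i)) =
    (\prod_(i : I) P (X i @^-1` B i))%E.

(* W : a family of n*d independent standard one-dimensional Brownian motions
   W i k (equivalently n i.i.d. standard d-dimensional Brownian motions, the
   i-th being the i-th row).  Characterised by W_0 = 0, continuous paths,
   and independent Gaussian increments N(0, t - s). *)
Definition std_brownian (n d : nat) (W : R -> Omega -> 'M[R]_(n, d)) : Prop :=
  [/\ (forall w, W 0 w = 0),
      (forall w, {within `[0, +oo[, continuous (fun t => W t w)}) &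
      forall (K : nat) (ts : nat -> R),
        0 <= ts 0%N -> (forall j, (j < K)%N -> ts j < ts j.+1) ->
        let inc (x : 'I_K * 'I_n * 'I_d) (w : Omega) :=
          W (ts x.1.1.+1) w x.1.2 x.2 - W (ts x.1.1) w x.1.2 x.2 in
        mutually_independent inc /\
        forall x : 'I_K * 'I_n * 'I_d, forall B : set R, measurable B ->
          P (inc x @^-1` B) =
          normal_prob 0 (Num.sqrt (ts x.1.1.+1 - ts x.1.1)) B].

(* an adapted-free notion of a process: measurable at each time, paths
   continuous on [0, +oo) for every outcome *)
Definition good_process (n d : nat) (X : R -> Omega -> 'M[R]_(n, d)) : Prop :=
  (forall t (i : 'I_n) (k : 'I_d), measurable_fun setT (fun w => X t w i k)) /\
  (forall w, {within `[0, +oo[, continuous (fun t => X t w)}).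

End Prob.

End Defs.

(* Main.v *)
Require Import Defs.
From HB Require Import structures.
From mathcomp Require Import all_boot all_order all_algebra.
From mathcomp Require Import all_classical all_reals all_analysis.
From mathcomp Require Import measurable_realfun ring lra.
Set Implicit Arguments. Unset Strict Implicit. Unset Printing Implicit Defensive.
Import Order.TTheory GRing.Theory Num.Theory.
Import numFieldNormedType.Exports.
Local Open Scope classical_set_scope.
Local Open Scope ring_scope.

(** The noise is additive, so everything can be done path by path. The difference of the
    relativistic and the Langevin momenta does not contain the noise; the force is
    Lipschitz near the (compact) Langevin path, and a Gronwall and continuation argument gives
    uniform convergence on [0, T] along every sequence eps -> 0, almost surely. This settles the
    first part by bounded convergence.

    For the moments one needs an integrable bound uniform in eps. Split the noise as
    sqrt 2 w = z + f, with f a moving average over windows of length 1/M, chosen so short that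
    |z| <= dl, and put y = p - z. The energy of (q, y) grows at a rate containing dl |grad G(q)|,
    while the radial momentum <y, q>/|q| grows at least like a multiple of |grad G(q)|, so that
    energy minus a multiple of radial momentum obeys a linear differential inequality. It yields
    |q| + |p| <= C exp(eta M) with eta as small as we please and C, eta independent of eps. The
    number M of windows needed has an exponential tail: chain over dyadic scales, using
    only Gaussian tails of the increments and the union bound. Dominated convergence concludes. *)

(** * Frobenius inner product *)

(** The radial momentum helps because near the origin [- grad G] is close to [a4 q / |q|^(b1+1)], an
    outward push comparable in size to |grad G|. Replacing p by y spoils two identities: force and
    velocity no longer pair exactly, which puts 2 dl |grad G| into the energy rate, and the
    centrifugal part of the radial rate loses up to dl^2 / (4 |q|). For b1 = 1 this loss has the
    order of the repulsion itself, whence the constraint dl^2 <= a4 / 4.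

    The relativistic kinetic energy grows only linearly in |y|, with slope of order eps^(-1/2), so
    it dominates the multiple of the radial momentum only for small eps.

    The smoothed noise has a derivative of size dl M. Young's inequality with a free weight turns it
    into a growth rate eta M; since the exponential tail of M has a fixed rate, this freedom in eta
    is what gives moments of every order.

    Each eps has its own null set, so limits are taken along sequences, where only countably many
    null sets are discarded. *)

Section frobenius.
Context {R : realType} {n d : nat}.
Implicit Types (u v w : 'M[R]_(n, d)) (a : R).

Definition dotm u v : R := \sum_(i < n) \sum_(k < d) u i k * v i k.

Lemma dotmC u v : dotm u v = dotm v u.
Proof. by do 2![apply: eq_bigr => ? _]; rewrite mulrC. Qed.

Lemma dotmDl u v w : dotm (u + v) w = dotm u w + dotm v w.
Proof.
rewrite /dotm -big_split; apply: eq_bigr => i _; rewrite -big_split.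
by apply: eq_bigr => k _; rewrite /= mxE mulrDl.
Qed.

Lemma dotmZl a u w : dotm (a *: u) w = a * dotm u w.
Proof.
rewrite /dotm mulr_sumr; apply: eq_bigr => i _; rewrite mulr_sumr.
by apply: eq_bigr => k _; rewrite mxE mulrA.
Qed.

Lemma dotmNl u w : dotm (- u) w = - dotm u w.
Proof. by rewrite -scaleN1r dotmZl mulN1r. Qed.

Lemma dotmBl u v w : dotm (u - v) w = dotm u w - dotm v w.
Proof. by rewrite dotmDl dotmNl. Qed.

Lemma dotmDr u v w : dotm w (u + v) = dotm w u + dotm w v.
Proof. by rewrite dotmC dotmDl !(dotmC w). Qed.

Lemma dotmZr a u w : dotm w (a *: u) = a * dotm w u.
Proof. by rewrite dotmC dotmZl (dotmC w). Qed.

Lemma dotmNr u w : dotm w (- u) = - dotm w u.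
Proof. by rewrite dotmC dotmNl (dotmC w). Qed.

Lemma dotmBr u v w : dotm w (u - v) = dotm w u - dotm w v.
Proof. by rewrite dotmDr dotmNr. Qed.

Definition dotmE := (dotmDl, dotmDr, dotmNl, dotmNr, dotmZl, dotmZr).

Lemma dotm_ge0 u : 0 <= dotm u u.
Proof. by do 2![apply: sumr_ge0 => ? _]; rewrite -expr2 sqr_ge0. Qed.

Lemma enorm_ge0 u : 0 <= enorm u. Proof. exact: sqrtr_ge0. Qed.

Lemma enorm_sqr u : enorm u ^+ 2 = dotm u u.
Proof.
have -> : enorm u = Num.sqrt (dotm u u).
  by congr Num.sqrt; do 2![apply: eq_bigr => ? _]; rewrite expr2.
by rewrite sqr_sqrtr// dotm_ge0.
Qed.

Lemma enormE u : enorm u = Num.sqrt (dotm u u).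
Proof. by rewrite -enorm_sqr sqrtr_sqr ger0_norm// enorm_ge0. Qed.

Lemma coord_le_enorm u i k : `|u i k| <= enorm u.
Proof.
rewrite -(@ler_pXn2r _ 2)// ?nnegrE ?normr_ge0 ?enorm_ge0// enorm_sqr.
rewrite /dotm (bigD1 i)//= (bigD1 k)//= -addrA.
rewrite -expr2 -normrX ger0_norm ?sqr_ge0// lerDl addr_ge0//.
  by apply: sumr_ge0 => ? _; rewrite -expr2 sqr_ge0.
by do 2![apply: sumr_ge0 => ? _]; rewrite -expr2 sqr_ge0.
Qed.

Lemma enorm_eq0 u : (enorm u == 0) = (u == 0).
Proof.
apply/eqP/eqP => [u0|->].
  apply/matrixP => i k; rewrite mxE; apply/eqP; rewrite -normr_le0 -u0.
  exact: coord_le_enorm.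
rewrite enormE (_ : dotm 0 0 = 0) ?sqrtr0//.
by rewrite -(scale0r 0) dotmZl mul0r.
Qed.

Lemma enorm_gt0 u : (0 < enorm u) = (u != 0).
Proof. by rewrite lt_def enorm_ge0 andbT enorm_eq0. Qed.

Lemma enorm0 : enorm (0 : 'M[R]_(n, d)) = 0.
Proof. by apply/eqP; rewrite enorm_eq0. Qed.

Lemma enormZ a u : enorm (a *: u) = `|a| * enorm u.
Proof.
by rewrite !enormE dotmZl dotmZr mulrA -expr2 sqrtrM ?sqr_ge0// sqrtr_sqr.
Qed.

Lemma enormN u : enorm (- u) = enorm u.
Proof. by rewrite -scaleN1r enormZ normrN1 mul1r. Qed.

Lemma enormB_sym u v : enorm (u - v) = enorm (v - u).
Proof. by rewrite -enormN opprB. Qed.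

Lemma cauchy_schwarz u v : `|dotm u v| <= enorm u * enorm v.
Proof.
have [->|v0] := eqVneq v 0.
  by rewrite enorm0 mulr0 -(scale0r 0) dotmZr mul0r normr0.
have v2 : 0 < dotm v v by rewrite -enorm_sqr exprn_gt0// enorm_gt0.
rewrite -(@ler_pXn2r _ 2)// ?nnegrE ?normr_ge0 ?mulr_ge0 ?enorm_ge0//.
rewrite -normrX ger0_norm ?sqr_ge0// exprMn !enorm_sqr.
have := dotm_ge0 (dotm v v *: u - dotm u v *: v).
rewrite !dotmE (dotmC v u).
rewrite (_ : _ + _ = dotm v v * (dotm u u * dotm v v - dotm u v ^+ 2)); last ring.
by rewrite pmulr_rge0// subr_ge0.
Qed.

Lemma dotm_le u v : dotm u v <= enorm u * enorm v.
Proof. exact: le_trans (ler_norm _) (cauchy_schwarz u v). Qed.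

Lemma dotm_ge u v : - (enorm u * enorm v) <= dotm u v.
Proof. by have := cauchy_schwarz u v; rewrite ler_norml => /andP[]. Qed.

Lemma enormD u v : enorm (u + v) <= enorm u + enorm v.
Proof.
rewrite -(@ler_pXn2r _ 2)// ?nnegrE ?addr_ge0 ?enorm_ge0//.
rewrite sqrrD !enorm_sqr !dotmE (dotmC v u).
have := dotm_le u v; lra.
Qed.

Lemma enormB u v : enorm (u - v) <= enorm u + enorm v.
Proof. by rewrite (le_trans (enormD _ _))// enormN. Qed.

Lemma enorm_sum (I : finType) (F : I -> 'M[R]_(n, d)) :
  enorm (\sum_i F i) <= \sum_i enorm (F i).
Proof.
elim/big_ind2 : _ => [|u a v b ua vb|//]; first by rewrite enorm0.
exact: le_trans (enormD _ _) (lerD ua vb).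
Qed.

Lemma enorm_delta_mx i k : enorm (delta_mx i k : 'M[R]_(n, d)) = 1.
Proof.
rewrite enormE /dotm (bigD1 i)//= (bigD1 k)//= !mxE !eqxx/= mulr1.
rewrite big1 ?addr0 => [|l lk]; last by rewrite !mxE (negbTE lk) andbF mulr0.
rewrite big1 ?addr0 ?sqrtr1// => j ji.
by rewrite big1// => l _; rewrite !mxE (negbTE ji) mulr0.
Qed.

Lemma enorm_le_sum u : enorm u <= \sum_(i < n) \sum_(k < d) `|u i k|.
Proof.
rewrite {1}[u]matrix_sum_delta (le_trans (enorm_sum _))//.
apply: ler_sum => i _; rewrite (le_trans (enorm_sum _))//.
by apply: ler_sum => k _; rewrite enormZ enorm_delta_mx mulr1.
Qed.

Lemma enorm_le_coord u a : (forall i k, `|u i k| <= a) ->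
  enorm u <= (n * d)%:R * a.
Proof.
move=> ua; rewrite (le_trans (enorm_le_sum _))//.
have H i : \sum_(k < d) `|u i k| <= a *+ d.
  rewrite (le_trans (ler_sum _ (fun k _ => ua i k)))//.
  by rewrite sumr_const card_ord.
rewrite (le_trans (ler_sum _ (fun i _ => H i)))//.
by rewrite sumr_const card_ord -mulrnA mulnC mulr_natl.
Qed.

Lemma mxnorm_le_enorm u : `|u| <= enorm u.
Proof.
rewrite /Num.Def.normr/= mx_normrE; apply: bigmax_le => [|i _].
  exact: enorm_ge0.
exact: coord_le_enorm.
Qed.

Lemma coord_le_mxnorm u i k : `|u i k| <= `|u|.
Proof. by rewrite [leRHS]/Num.Def.normr/= mx_normrE (le_bigmax _ _ (i, k)). Qed.

Lemma enorm_le_mxnorm u : enorm u <= (n * d)%:R * `|u|.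
Proof. by apply: enorm_le_coord => i k; exact: coord_le_mxnorm. Qed.

End frobenius.

(** * Differentiable and continuous paths *)

Section paths.
Context {R : realType} {n d : nat}.
Implicit Types (x y : R -> 'M[R]_(n, d)) (t : R).

Lemma is_derive_mxP x t (x' : 'M[R]_(n, d)) :
  is_derive t 1 x x' <-> forall i k, is_derive t 1 (fun s => x s i k) (x' i k).
Proof.
split=> [[dx <-] i k|H].
  have dxik := (derivable_mxP x t 1).1 dx i k.
  by apply: DeriveDef => //; rewrite derive_mx// mxE.
have dx : derivable x t 1 by apply/derivable_mxP => i k; case: (H i k).
apply: DeriveDef => //; rewrite derive_mx//; apply/matrixP => i k; rewrite mxE.
by case: (H i k).
Qed.

Lemma is_derive_dotm x y t (x' y' : 'M[R]_(n, d)) :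
  is_derive t 1 x x' -> is_derive t 1 y y' ->
  is_derive t 1 (fun s => dotm (x s) (y s)) (dotm x' (y t) + dotm (x t) y').
Proof.
move=> /is_derive_mxP dx /is_derive_mxP dy.
have -> : (fun s => dotm (x s) (y s)) =
    \sum_(i < n) \sum_(k < d) ((fun s => x s i k) * (fun s => y s i k)).
  apply/funext => s; rewrite fct_sumE; apply: eq_bigr => i _.
  by rewrite fct_sumE.
rewrite /dotm -big_split; apply: is_derive_sum => i.
rewrite -big_split; apply: is_derive_sum => k.
apply: (is_derive_eq (is_deriveM (dx i k) (dy i k))).
by rewrite /= /GRing.scale/= addrC; congr (_ + _); rewrite mulrC.
Qed.

End paths.

Section chain.
Context {R : realType} {d : nat}.
Implicit Types (f : 'rV[R]_d -> R) (x : R -> 'rV[R]_d) (t : R).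

Lemma diff_grad f a v : differentiable f a -> 'd f a v = dotm (grad f a) v.
Proof.
move=> df; rewrite {1}[v]row_sum_delta linear_sum /dotm big_ord1.
by apply: eq_bigr => k _; rewrite linearZ/= mxE mulrC.
Qed.

Lemma is_derive_grad f x t (x' : 'rV[R]_d) : is_derive t 1 x x' -> differentiable f (x t) ->
  is_derive t 1 (fun s => f (x s)) (dotm (grad f (x t)) x').
Proof.
move=> [dx xE] df.
have dx' : differentiable x t by apply/derivable1_diffP.
have dfx : differentiable (f \o x) t by apply: differentiable_comp.
apply: DeriveDef; first by apply/derivable1_diffP.
have xd : 'D_1 x t = 'd x t 1 by rewrite deriveE.
have -> : 'D_1 (fun s => f (x s)) t = 'd (f \o x) t 1 by rewrite -deriveE.
by rewrite -diff_grad// -xE xd diff_comp.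
Qed.

End chain.


(** * Gronwall's inequality and continuity of matrix-valued paths *)

(** The function [f t * exp (- C t)] has a nonpositive derivative. The derivative is asked only
    inside the interval because the paths in use are frozen before time 0 and may have a kink
    there. *)
Lemma gronwall (R : realType) (f df : R -> R) (C T : R) :
  continuous f ->
  (forall t : R, 0 < t < T -> is_derive t 1 f (df t)) ->
  (forall t, 0 < t < T -> df t <= C * f t) ->
  forall t, 0 <= t <= T -> f t <= f 0 * expR (C * t).
Proof.
move=> cf Df dfC t /andP[t0 tT].
pose g s := f s * expR (- C * s).
have Dg (s : R) : 0 < s < T ->
    is_derive s 1 g ((df s - C * f s) * expR (- C * s)).
  move=> sT; have := Df s sT => Dfs.
  have : is_derive s 1 (f * (expR \o ( *%R (- C)))) ((df s - C * f s) * expR (- C * s)).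
    by apply: is_derive_eq; rewrite /GRing.scale/=; ring.
  by [].
have cg : continuous g.
  move=> s; apply: cvgM; first exact: cf.
  apply: continuous_comp; last exact: continuous_expR.
  by apply: cvgM; [exact: cvg_cst|exact: cvg_id].
have : g t <= g 0.
  apply: (@ler0_derive1_le_cc _ g 0 T); rewrite ?in_itv/= ?lexx ?t0 ?tT//.
  - by move=> s; rewrite in_itv/= => /Dg[].
  - move=> s; rewrite in_itv/= => sT; rewrite derive1E.
    have [_ ->] := Dg s sT.
    by rewrite pmulr_lle0 ?expR_gt0// subr_le0 dfC.
  - exact: continuous_subspaceT.
  - exact: le_trans tT.
rewrite /g mulr0 expR0 mulr1 mulNr expRN.
by rewrite ler_pdivrMr ?expR_gt0.
Qed.

(** Freezing a path at its initial value for negative times lets later statements ask for plain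
    continuity on the whole line. *)
Lemma continuous_clamp (R : realType) (V : pseudoMetricNormedZmodType R)
    (f : R -> V) :
  {within `[0, +oo[, continuous f} -> continuous (fun t : R => f (Num.max 0 t)).
Proof.
move=> cf t.
have cm : {for t, continuous (fun t : R => Num.max 0 t)}.
  by apply: continuous_max; [exact: cvg_cst|exact: cvg_id].
have m0 : `[0, +oo[%classic (Num.max 0 t) by rewrite /= in_itv/= andbT le_max lexx.
move/subspace_continuousP : cf => /(_ _ m0) cf.
apply: cvg_comp (cf).
move=> A /=; rewrite /within/= => hA.
have : nbhs t ((fun s : R => Num.max 0 s) @^-1` [set x | `[0, +oo[%classic x -> A x]).
  exact: cm.
apply: filterS => s /=; apply.
by rewrite /= in_itv/= andbT le_max lexx.
Qed.

Lemma continuous_mxP (R : realType) (T : topologicalType) n d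
    (x : T -> 'M[R]_(n, d)) (t : T) :
  {for t, continuous x} <-> forall i k, {for t, continuous (fun s => x s i k)}.
Proof.
split=> [cx i k|H].
  apply: (@continuous_comp _ _ _ x (fun M : 'M[R]_(n, d) => M i k)) => //.
  exact: coord_continuous.
apply/cvgrPdist_le => e e0; near=> s.
rewrite /Num.Def.normr/= mx_normrE; apply: bigmax_le => [|[i k] _]; first exact: ltW.
rewrite /= !mxE; move: i k; near: s.
apply: filter_forall => i; apply: filter_forall => k.
by move/cvgrPdist_le : (H i k); apply.
Unshelve. all: by end_near. Qed.

Section continuity.
Context {R : realType} {T : topologicalType} {n d : nat}.
Implicit Types (x y : T -> 'M[R]_(n, d)) (t : T).

Lemma continuous_sum (I : finType) (f : I -> T -> R) t :
  (forall i, {for t, continuous (f i)}) ->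
  {for t, continuous (fun s => \sum_i f i s)}.
Proof.
move=> cf; rewrite /index_enum; elim: (Finite.enum I) => [|i r IH].
  rewrite (_ : (fun _ => _) = cst 0); first exact: cvg_cst.
  by apply/funext => s; rewrite big_nil.
rewrite (_ : (fun _ => _) = (fun s => f i s + \sum_(i <- r) f i s)).
  by apply: cvgD; [exact: cf|exact: IH].
by apply/funext => s; rewrite big_cons.
Qed.

Lemma continuous_dotm x y t : {for t, continuous x} -> {for t, continuous y} ->
  {for t, continuous (fun s => dotm (x s) (y s))}.
Proof.
move=> /continuous_mxP cx /continuous_mxP cy.
apply: continuous_sum => i; apply: continuous_sum => k.
by apply: cvgM; [exact: cx|exact: cy].
Qed.

Lemma continuous_enorm x t : {for t, continuous x} ->
  {for t, continuous (fun s => enorm (x s))}.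
Proof.
move=> cx; have -> : (fun s => enorm (x s)) = (fun s => Num.sqrt (dotm (x s) (x s))).
  by apply/funext => s; rewrite enormE.
apply: (@continuous_comp _ _ _ (fun s => dotm (x s) (x s)) (@Num.sqrt R)).
  exact: continuous_dotm.
exact: sqrt_continuous.
Qed.

End continuity.

(** * Differential form of the equations *)

Section solutions.
Context {R : realType}.
Local Notation mu := (@lebesgue_measure R).

Lemma is_derive_integral (f x : R -> R) (a c : R) : continuous f ->
  (forall t, a <= t -> x t = c + \int[mu]_(s in `[a, t]) f s) ->
  forall t : R, a < t -> is_derive t 1 x (f t).
Proof.
move=> cf xE t t0.
have [] := @continuous_FTC1_closed R f a t (t + 1) _ _ t0 (cf t).
- by rewrite ltrDl.
- apply: continuous_compact_integrable; first exact: segment_compact.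
  exact: continuous_subspaceT.
set F := (F in derivable F); move=> dF FE.
have : is_derive t 1 (cst c + F) (f t).
  have : is_derive t 1 F (f t) by apply: DeriveDef; rewrite -?derive1E.
  by move=> dFt; apply: is_derive_eq; rewrite add0r.
apply: near_eq_is_derive; near=> s.
by rewrite xE// ltW//; near: s; exact: lt_nbhsr.
Unshelve. all: by end_near. Qed.

Context {n d : nat}.
Implicit Types (v : 'rV[R]_d -> 'rV[R]_d) (F : 'M[R]_(n, d) -> 'M[R]_(n, d)).

Definition rowmap v (p : 'M[R]_(n, d)) : 'M[R]_(n, d) :=
  \matrix_(i, k) v (row i p) 0 k.

Lemma continuous_row (T : topologicalType) (x : T -> 'M[R]_(n, d)) t i :
  {for t, continuous x} -> {for t, continuous (fun s => row i (x s))}.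
Proof.
move=> /continuous_mxP cx; apply/continuous_mxP => j k.
rewrite (_ : (fun _ => _) = (fun s => x s i k)); first exact: cx.
by apply/funext => s; rewrite mxE.
Qed.

(** The momentum itself is not differentiable; subtracting the noise leaves a function that is. The
    equations are stated for [t > 0] only, since a frozen path may have a kink at 0, and the initial
    values are recorded separately. *)
Definition path_sol v F (D : set 'M[R]_(n, d)) (q0 p0 : 'M[R]_(n, d))
    (w q p : R -> 'M[R]_(n, d)) : Prop :=
  [/\ forall t, D (q t), continuous q, continuous p, q 0 = q0 /\ p 0 = p0 &
      forall t : R, 0 < t -> is_derive t 1 q (rowmap v (p t)) /\
        is_derive t 1 (p - (fun s => Num.sqrt 2 *: w s))
          (- rowmap v (p t) - F (q t))].

(** The path stays in [D], where [F] is continuous, so the integrands are continuous and the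
    fundamental theorem of calculus applies. *)
Lemma is_solution_clamp v F D q0 p0 w q p :
  continuous v -> (forall x, D x -> {for x, continuous F}) -> w 0 = 0 ->
  is_solution v F D q0 p0 w q p ->
  path_sol v F D q0 p0 (w \o Num.max 0) (q \o Num.max 0) (p \o Num.max 0).
Proof.
move=> cv cF w0 [Dq /continuous_clamp cq /continuous_clamp cp qpE].
have m0 (t : R) : 0 <= Num.max 0 t by rewrite le_max lexx.
have mE (t : R) : 0 <= t -> Num.max 0 t = t by move=> t0; apply/max_idPr.
have cvp i k : continuous (fun s : R => v (row i (p (Num.max 0 s))) 0 k).
  move=> s.
  have : {for s, continuous (fun s : R => v (row i (p (Num.max 0 s))))}.
    apply: (@continuous_comp _ _ _ (fun s : R => row i (p (Num.max 0 s))) v).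
      exact: continuous_row (cp s).
    exact: cv.
  by move=> /continuous_mxP/(_ 0 k).
have cFq i k : continuous (fun s : R => F (q (Num.max 0 s)) i k).
  move=> s.
  have : {for s, continuous (fun s : R => F (q (Num.max 0 s)))}.
    apply: (@continuous_comp _ _ _ (fun s : R => q (Num.max 0 s)) F); first exact: cq.
    exact: cF (Dq _ (m0 s)).
  by move=> /continuous_mxP/(_ i k).
have iE (f : R -> R) t :
    \int[mu]_(s in `[0, t]) f (Num.max 0 s) = \int[mu]_(s in `[0, t]) f s.
  apply: eq_Rintegral => s; rewrite inE/= in_itv/= => /andP[s0 _].
  by rewrite mE.
split=> //.
- by move=> t; exact: Dq.
- rewrite /= maxxx; split; apply/matrixP => i k; have [qE pE] := qpE 0 (lexx _) i k.
    by rewrite qE set_itv1 Rintegral_set1 addr0.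
  by rewrite pE set_itv1 Rintegral_set1 w0 mxE mulr0 !addr0.
- move=> t t0; split; apply/is_derive_mxP => i k.
    rewrite mxE; apply: is_derive_integral (cvp i k) _ _ t0 => s s0.
    have [+ _] := qpE s s0 i k; rewrite /= mE// => ->; congr (_ + _).
    by rewrite -(iE (fun s => v (row i (p s)) 0 k)).
  pose f s := - v (row i (p s)) 0 k - F (q s) i k.
  have -> : (- rowmap v ((p \o Num.max 0) t) - F ((q \o Num.max 0) t)) i k =
      f (Num.max 0 t) by rewrite !mxE.
  apply: (@is_derive_integral (f \o Num.max 0) _ 0 (p0 i k)) _ t0 => [s|s s0].
    by apply: cvgD; apply: cvgN; [exact: cvp|exact: cFq].
  have [_] := qpE s s0 i k; rewrite !fctE/= mE// !mxE => ->.
  by rewrite iE addrK.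
Qed.

End solutions.

(** * Local Lipschitz continuity of the forces *)

Section loclip.
Context {R : realType}.

(** Both points vary in the neighbourhood, so the bound can be recentred at nearby points, as the
    compactness argument along a path requires. Distances between matrices are in the sup norm. *)
Definition loclip (V W : normedModType R) (f : V -> W) (x : V) : Prop :=
  exists2 L : R, 0 <= L & exists2 A, nbhs x A &
    forall y z, A y -> A z -> `|f y - f z| <= L * `|y - z|.

Lemma loclip_continuous (V W : normedModType R) (f : V -> W) x :
  loclip f x -> {for x, continuous f}.
Proof.
move=> [L L0 [A xA fA]]; apply/cvgrPdist_le => e e0.
have L1 : 0 < L + 1 by rewrite ltr_wpDl.
near=> y; rewrite (le_trans (fA _ _ _ _))//.
- exact: nbhs_singleton.
- by near: y.
- rewrite (@le_trans _ _ ((L + 1) * `|x - y|))//.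
    by rewrite ler_wpM2r// lerDl.
  rewrite -ler_pdivlMl//; near: y; apply: cvgr_dist_le; first exact: cvg_id.
  by rewrite mulr_gt0// invr_gt0.
Unshelve. all: by end_near. Qed.

Lemma loclipD (V W : normedModType R) (f g : V -> W) x :
  loclip f x -> loclip g x -> loclip (f + g) x.
Proof.
move=> [L L0 [A xA fA]] [M M0 [B xB gB]]; exists (L + M); first exact: addr_ge0.
exists (A `&` B); first exact: filterI.
move=> y z [Ay By] [Az Bz]; rewrite !fctE opprD addrACA mulrDl.
by rewrite (le_trans (ler_normD _ _))// lerD ?fA ?gB.
Qed.

Lemma loclip_sum (V W : normedModType R) (I : finType) (P : pred I)
    (f : I -> V -> W) x : (forall i, P i -> loclip (f i) x) ->
  loclip (\sum_(i | P i) f i) x.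
Proof.
move=> H; elim/big_ind : _ => [||//]; last by move=> *; exact: loclipD.
exists 0 => //; exists setT; first exact: filterT.
by move=> y z _ _; rewrite subrr normr0 mul0r.
Qed.

Lemma loclip_comp (U V W : normedModType R) (f : V -> W) (g : U -> V) (C : R) x :
  (forall y z, `|g y - g z| <= C * `|y - z|) -> 0 <= C ->
  loclip f (g x) -> loclip (f \o g) x.
Proof.
move=> gC C0 [L L0 [A xA fA]]; exists (L * C); first exact: mulr_ge0.
have gL : loclip g x by exists C => //; exists setT => //; exact: filterT.
exists (g @^-1` A); first by apply: loclip_continuous.
by move=> y z Ay Az; rewrite (le_trans (fA _ _ Ay Az))// -mulrA ler_wpM2l.
Qed.

Lemma loclip_mx (V : normedModType R) n d (f : V -> 'M[R]_(n, d)) x :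
  (forall i k, loclip (fun y => f y i k) x) -> loclip f x.
Proof.
move=> H.
have {H} /choice[h H] : forall ik : 'I_n * 'I_d, exists LA : R * set V,
    [/\ 0 <= LA.1, nbhs x LA.2 & forall y z, LA.2 y -> LA.2 z ->
    `|f y ik.1 ik.2 - f z ik.1 ik.2| <= LA.1 * `|y - z|].
  by move=> [i k]; have [L L0 [A xA fA]] := H i k; exists (L, A).
have s0 : 0 <= \sum_ik (h ik).1 by apply: sumr_ge0 => ik _; case: (H ik).
exists (\sum_ik (h ik).1) => //.
exists [set y | forall ik, (h ik).2 y].
  by apply: filter_forall => ik; case: (H ik).
move=> y z Ay Az; rewrite [leLHS]/Num.Def.normr/= mx_normrE.
apply: bigmax_le => [|ik _]; first by rewrite mulr_ge0.
have [L0 _ fL] := H ik.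
rewrite !mxE (le_trans (fL _ _ (Ay ik) (Az ik)))// ler_wpM2r//.
rewrite (bigD1 ik)//= lerDl; apply: sumr_ge0 => j _; by case: (H j).
Qed.

(** The first derivatives of a partial derivative of [f] are continuous, hence bounded on a ball
    around [x] inside [A]. Balls are convex, and the mean value theorem along the segment from [z]
    to [y] gives the Lipschitz constant [C x + 1]. *)
Lemma loclip_grad d (A : set 'rV[R]_d) (f : 'rV[R]_d -> R) x :
  open A -> smooth_on A f -> A x -> loclip (grad f) x.
Proof.
move=> oA sf Ax; apply: loclip_mx => i k.
have [_ /(_ (delta_mx 0 k))[dg cg]] := sf 2%N.
pose g y := 'd f y (delta_mx 0 k).
rewrite (_ : (fun y => grad f y i k) = g); last by apply/funext => y; rewrite mxE.
pose C y := \sum_(j < d) `|'d g y (delta_mx 0 j)|.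
have cC : {for x, continuous C}.
  apply: continuous_sum => j; apply: continuous_comp; first exact: cg.
  exact: norm_continuous.
have C0 y : 0 <= C y by apply: sumr_ge0.
exists (C x + 1); first by rewrite addr_ge0.
have : \forall y \near x, A y /\ C y <= C x + 1.
  near=> y; split; first by near: y; exact: open_nbhs_nbhs.
  near: y; have /cvgr_le := cC; apply; by rewrite ltrDl.
move=> /nbhs_ballP[e /= e0 eA].
exists (ball x e); first exact: nbhsx_ballx.
move=> y z ye ze.
pose l (t : R) := z + t *: (y - z).
have ball_l t : 0 <= t <= 1 -> ball x e (l t).
  move=> /andP[t0 t1]; move: ye ze; rewrite -!ball_normE/= => ye ze.
  have -> : x - l t = (1 - t) *: (x - z) + t *: (x - y).
    rewrite /l; apply/matrixP => a b; rewrite !mxE; ring.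
  rewrite (le_lt_trans (ler_normD _ _))// !normrZ.
  rewrite (ger0_norm t0) ger0_norm ?subr_ge0//.
  have := ler_wpM2l t0 (ltW ye).
  have [t11|t11] := eqVneq t 1; first by rewrite t11 subrr mul0r mul1r add0r.
  have : (1 - t) * `|x - z| < (1 - t) * e.
    by rewrite ltr_pM2l// subr_gt0 lt_neqAle t11.
  lra.
have dl (t : R) : is_derive t 1 l (y - z).
  apply/is_derive_mxP => a b.
  rewrite (_ : (fun s => l s a b) = cst (z a b) + (fun s : R => s * (y - z) a b)); last first.
    by apply/funext => s; rewrite /l !mxE.
  by apply: is_derive_eq; rewrite scaler0 add0r add0r /GRing.scale/= mulr1.
have dgl (t : R) : 0 <= t <= 1 -> is_derive t 1 (fun s => g (l s)) (dotm (grad g (l t)) (y - z)).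
  by move=> t01; apply: is_derive_grad => //; apply: dg; apply: (eA _ (ball_l t t01)).1.
have dgl' (t : R) : t \in `]0, 1[ ->
    is_derive t 1 (fun s => g (l s)) (dotm (grad g (l t)) (y - z)).
  by rewrite in_itv/= => /andP[t0 t1]; apply: dgl; rewrite !ltW.
have cgl : {within `[0, 1], continuous (fun s : R => g (l s))}.
  by apply: derivable_within_continuous => t; rewrite in_itv/= => /dgl[].
have [t t01] := MVT_segment ler01 dgl' cgl.
have -> : l 0 = z by rewrite /l scale0r addr0.
have -> : l 1 = y by rewrite /l scale1r addrC subrK.
rewrite subr0 mulr1 => ->.
have := t01; rewrite in_itv/= => /ball_l /eA[Alt Clt].
rewrite -diff_grad; last exact: dg.
rewrite {1}[y - z]row_sum_delta linear_sum.
rewrite (le_trans (ler_norm_sum _ _ _))//.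
rewrite (@le_trans _ _ (C (l t) * `|y - z|))//; last by rewrite ler_wpM2r.
rewrite mulr_suml; apply: ler_sum => j _.
by rewrite linearZ/= normrM mulrC ler_wpM2l// coord_le_mxnorm.
Unshelve. all: by end_near. Qed.

End loclip.

Section forces.
Context {R : realType}.

Lemma loclip_coord (V : normedModType R) n d (f : V -> 'M[R]_(n, d)) x i k :
  loclip f x -> loclip (fun y => f y i k) x.
Proof.
move=> [L L0 [A xA fA]]; exists L => //; exists A => // y z Ay Az.
apply: le_trans (fA _ _ Ay Az); have := coord_le_mxnorm (f y - f z) i k.
by rewrite !mxE.
Qed.

Lemma mxnorm_row n d (M : 'M[R]_(n, d)) i : `|row i M| <= `|M|.
Proof.
rewrite [leLHS]/Num.Def.normr/= mx_normrE; apply: bigmax_le => // -[j k] _.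
by rewrite mxE coord_le_mxnorm.
Qed.

Context {d : nat} {U G : 'rV[R]_d -> R}.
Hypothesis sU : smooth_on setT U.
Hypothesis sG : smooth_on (~` [set 0]) G.

Lemma open_setC0 : open (~` [set (0 : 'rV[R]_d)]).
Proof. by apply: closed_openC; apply: accessible_closed_set1; exact: hausdorff_accessible. Qed.

Lemma loclip_force1 (q : 'rV[R]_d) : (~` [set 0]) q -> loclip (force1 U G) q.
Proof.
move=> q0; apply: (@loclipD _ _ _ (grad U) (grad G)).
  exact: loclip_grad openT sU _.
exact: loclip_grad open_setC0 sG q0.
Qed.

Lemma loclip_forceN N (q : 'M[R]_(N, d)) : noncoll q -> loclip (forceN U G) q.
Proof.
move=> ncq; apply: loclip_mx => i k.
pose f := (grad U \o @row _ _ _ i) +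
  \sum_(j < N | j != i) (grad G \o (fun q : 'M[R]_(N, d) => row i q - row j q)).
have -> : (fun y : 'M[R]_(N, d) => forceN U G y i k) = (fun y => f y 0 k).
  apply/funext => y; rewrite mxE /f; congr (fun_of_matrix _ 0 k).
  by rewrite fctE; congr (_ + _); rewrite fct_sumE.
apply: loclip_coord; apply: loclipD.
  apply: (@loclip_comp _ _ _ _ _ _ 1) => //; last exact: loclip_grad openT sU _.
  by move=> y z; rewrite -linearB mul1r; exact: mxnorm_row.
apply: loclip_sum => j ji; apply: (@loclip_comp _ _ _ _ _ _ 2) => //.
  move=> y z.
  have -> : (row i y - row j y) - (row i z - row j z) =
      row i (y - z) - row j (y - z).
    by apply/matrixP => a b; rewrite !mxE; ring.
  by rewrite (le_trans (ler_normB _ _))// mulr_natl mulr2n lerD// mxnorm_row.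
apply: loclip_grad open_setC0 sG _ => /= /eqP; rewrite subr_eq0.
by apply/negP; apply: ncq; rewrite eq_sym.
Qed.

End forces.

(** * The relativistic velocity and its Newtonian limit *)

Section relvel.
Context {R : realType} {d : nat}.
Implicit Types (p y : 'rV[R]_d) (eps : R).

Lemma relvel_gamma_ge1 eps p : 0 <= eps ->
  1 <= Num.sqrt (1 + eps * enorm p ^+ 2).
Proof.
move=> e0; rewrite -[leLHS]sqrtr1 ler_wsqrtr// lerDl.
by rewrite mulr_ge0 ?sqr_ge0.
Qed.

Lemma continuous_relvel eps : 0 <= eps -> continuous (@relvel R eps d).
Proof.
move=> e0 p.
have c1 : {for p, continuous (@enorm R 1 d)} by apply: continuous_enorm; exact: cvg_id.
have c2 : {for p, continuous (fun p : 'rV[R]_d => 1 + eps * enorm p ^+ 2)}.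
  have c0 (a : R) : {for p, continuous (cst a : 'rV[R]_d -> R)}.
    exact: cst_continuous.
  exact: continuousD (c0 1) (continuousM (c0 eps) (continuousM c1 c1)).
have c3 := continuous_comp c2 (@sqrt_continuous R _).
suff c4 : {for p, continuous (fun p => (Num.sqrt (1 + eps * enorm p ^+ 2))^-1)}.
  exact: cvgZ c4 cvg_id.
apply: (continuousV _ c3).
by rewrite gt_eqF// (lt_le_trans ltr01)// relvel_gamma_ge1.
Qed.

(** The Langevin system is the case eps = 0 of the relativistic one, so estimates stated for
    [0 <= eps] cover both. *)
Lemma relvel0 : @relvel R 0 d = @langvel R d.
Proof. by apply/funext => p; rewrite /relvel mul0r addr0 sqrtr1 invr1 scale1r. Qed.

(** With g the Lorentz factor, [1 - 1/g <= g^2 - 1 = eps |p|^2]. The error is of order eps only on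
    bounded momenta, hence the bound [B] on the Langevin momentum in the comparison. *)
Lemma relvel_sub_id eps p : 0 <= eps ->
  enorm (relvel eps p - p) <= eps * enorm p ^+ 3.
Proof.
move=> e0; rewrite /relvel; have := relvel_gamma_ge1 p e0.
have := @sqr_sqrtr R (1 + eps * enorm p ^+ 2).
set g := Num.sqrt _ => gE g1.
have {gE}g2 : g ^+ 2 = 1 + eps * enorm p ^+ 2.
  by apply: gE; rewrite addr_ge0// mulr_ge0 ?sqr_ge0.
rewrite -[X in _ - X]scale1r -scalerBl enormZ exprSr mulrA ler_wpM2r ?enorm_ge0//.
rewrite ler0_norm; last by rewrite subr_le0 invf_le1// (lt_le_trans ltr01).
rewrite opprB (_ : eps * _ = g ^+ 2 - 1); last by rewrite g2 addrC addKr.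
have gi : g * g^-1 = 1 by rewrite divff// gt_eqF// (lt_le_trans ltr01).
have : 0 <= g^-1 by rewrite invr_ge0 (le_trans ler01).
nra.
Qed.

End relvel.

(** * Pathwise convergence *)

(** The times in [[0, T]] with [c <= f] form a compact set; if there were any, the least one would
    contradict the hypothesis. At [tau = 0] the inner premise is vacuous, so the hypothesis contains
    the initial bound. *)
Lemma continuous_induction (R : realType) (f : R -> R) (c T : R) :
  continuous f ->
  (forall tau, 0 <= tau <= T -> (forall t, 0 <= t < tau -> f t < c) ->
    f tau < c) ->
  forall t, 0 <= t <= T -> f t < c.
Proof.
move=> cf ind t1 t1T; rewrite ltNge; apply/negP => ct1.
pose S := `[0, T]%classic `&` f @^-1` [set x | c <= x].
have cS : compact S.
  apply: compact_closedI; first exact: segment_compact.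
  by apply: closed_comp; [move=> x _; exact: cf|exact: closed_ge].
have S0 : S !=set0 by exists t1; split => //; rewrite /= in_itv.
have cid : {within S, continuous (fun x : R => x)}.
  by apply: continuous_subspaceT => x; exact: cvg_id.
have [tau] := compact_EVT_min S0 cS cid.
rewrite inE => -[]; rewrite /= in_itv/= => tauT ctau mint.
suff : f tau < c by rewrite ltNge ctau.
apply: ind => // t /andP[t0 tt]; rewrite ltNge; apply/negP => ct.
have /mint : t \in S.
  rewrite inE; split => //=; rewrite in_itv/= t0/=.
  by move/andP : tauT => [_]; apply: le_trans; exact: ltW.
by rewrite leNgt tt.
Qed.

(** Compactness of [[0, T]] makes the local constants uniform. One integer m carries both of them,
    as Lipschitz constant m and radius 1/(m+1), so the covering argument runs along the filter at
    infinity. *)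
Lemma loclip_path (R : realType) n d (F : 'M[R]_(n, d) -> 'M[R]_(n, d))
    (q : R -> 'M[R]_(n, d)) (T : R) :
  continuous q -> (forall t, loclip F (q t)) ->
  exists L r : R, [/\ 0 <= L, 0 < r & forall t, 0 <= t <= T ->
    forall x, enorm (x - q t) <= r -> enorm (F x - F (q t)) <= L * enorm (x - q t)].
Proof.
move=> cq lF.
pose P (m : nat) t := forall x, `|x - q t| < m.+1%:R^-1 ->
  `|F x - F (q t)| <= m%:R * `|x - q t|.
have [m _ mP] : \forall m \near \oo, `[0, T]%classic `<=` P m.
  have /compact_near_coveringP : compact `[0, T]%classic by exact: segment_compact.
  apply => t _; have [L L0 [A /nbhs_ballP[e /= e0 eA] FA]] := lF t.
  have e20 : 0 < e / 2 by rewrite divr_gt0.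
  exists ([set s | ball (q t) (e / 2) (q s)], [set m | L <= m%:R /\ m.+1%:R^-1 < e / 2]).
    split; first by apply: cq; apply: nbhsx_ballx; rewrite divr_gt0.
    near=> m; split; near: m; first exact: nbhs_infty_ger.
    exact: (near_infty_natSinv_lt (PosNum e20)).
  move=> [s m] /= [qs [Lm me]] x xs.
  have Aq : A (q s) by apply: eA; apply: le_ball qs; rewrite ler_pdivrMr//; lra.
  have Ax : A x.
    apply: eA; apply: (ball_split qs); rewrite -ball_normE/= distrC.
    exact: lt_trans xs me.
  by rewrite (le_trans (FA _ _ Ax Aq))// ler_wpM2r.
exists ((n * d)%:R * m%:R), (m.+1%:R^-1 / 2); split.
- by rewrite mulr_ge0.
- by rewrite divr_gt0.
move=> t tT x xr; rewrite (le_trans (enorm_le_mxnorm _))//.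
rewrite -mulrA ler_wpM2l// (@le_trans _ _ (m%:R * `|x - q t|))//.
  apply: (mP m (leqnn m) t _ x); first by rewrite /= in_itv.
  rewrite (le_lt_trans (mxnorm_le_enorm _))// (le_lt_trans xr)//.
  by rewrite ltr_pdivrMr// ltr_pMr// ltr1n.
by rewrite ler_wpM2l// mxnorm_le_enorm.
Unshelve. all: by end_near. Qed.

Section comparison.
Context {R : realType} {n d : nat}.
Variables (F : 'M[R]_(n, d) -> 'M[R]_(n, d)) (D : set 'M[R]_(n, d)).
Hypothesis lF : forall x, D x -> loclip F x.

Lemma enorm_row (M : 'M[R]_(n, d)) i : enorm (row i M) <= enorm M.
Proof.
rewrite -(@ler_pXn2r _ 2)// ?nnegrE ?enorm_ge0// !enorm_sqr /dotm.
rewrite big_ord1 [leRHS](bigD1 i)//= -[leLHS]addr0 lerD//.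
  by rewrite le_eqVlt; apply/orP; left; apply/eqP/eq_bigr => k _; rewrite !mxE.
by do 2![apply: sumr_ge0 => ? _]; rewrite -expr2 sqr_ge0.
Qed.

Lemma rowmap_relvel_sub_id (eps : R) (p : 'M[R]_(n, d)) : 0 <= eps ->
  enorm (rowmap (@relvel R eps d) p - p) <= (n * d)%:R * (eps * enorm p ^+ 3).
Proof.
move=> e0; apply: enorm_le_coord => i k.
have -> : (rowmap (@relvel R eps d) p - p) i k = (relvel eps (row i p) - row i p) 0 k.
  by rewrite !mxE.
rewrite (le_trans (coord_le_enorm _ _ _))// (le_trans (relvel_sub_id _ e0))//.
by rewrite ler_wpM2l// lerXn2r ?nnegrE ?enorm_ge0// enorm_row.
Qed.

(* The noise cancels in pe - p, which is therefore differentiable; the squared distance then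
   satisfies a Gronwall inequality as long as it stays below the radius r of local
   Lipschitz continuity, and for small eps it never leaves that region. *)
Lemma newtonian_limit_path q0 p0 (w q p : R -> 'M[R]_(n, d)) (T xi : R) :
  0 < T -> 0 < xi -> path_sol (@langvel R d) F D q0 p0 w q p ->
  exists2 e0 : R, 0 < e0 & forall eps, 0 < eps < e0 -> forall qe pe,
    path_sol (@relvel R eps d) F D q0 p0 w qe pe ->
    forall t, 0 <= t <= T -> enorm (qe t - q t) + enorm (pe t - p t) < xi.
Proof.
move=> T0 xi0 [Dq cq cp [q00 p00] dqp].
have [L [r0 [L0 r00 FL]]] := loclip_path T cq (fun t => lF (Dq t)).
have [B B0 pB] : exists2 B : R, 0 <= B & forall t, 0 <= t <= T -> enorm (p t) <= B.
  have [|t0 _ H] := @EVT_max R (fun t => enorm (p t)) 0 T (ltW T0).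
    by apply: continuous_subspaceT => t; apply: continuous_enorm; exact: cp.
  exists (enorm (p t0)); first exact: enorm_ge0.
  by move=> t tT; apply: H; rewrite in_itv.
(* Below [r] the Lipschitz bound holds, [pe] has norm at most [B + 1], and the sum of the two
   distances stays under [xi]. *)
pose r := Num.min (Num.min r0 1) (xi / 2).
have rr0 : r <= r0 by rewrite /r !ge_min lexx.
have r1 : r <= 1 by rewrite /r !ge_min lexx orbT.
have rxi : r <= xi / 2 by rewrite /r !ge_min lexx orbT.
have r_gt0 : 0 < r by rewrite !lt_min r00 ltr01 divr_gt0.
pose K : R := (n * d)%:R * (B + 1) ^+ 3 + 1.
have K0 : 0 < K.
  by rewrite ltr_wpDl// mulr_ge0// exprn_ge0// addr_ge0.
pose C := 4 + L.
have eC0 : 0 < expR (C * T) by exact: expR_gt0.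
pose e0 : R := r / (K * expR (C * T)).
have e00 : 0 < e0 by rewrite divr_gt0// mulr_gt0.
exists e0 => // eps /andP[eps0 epse0] qe pe [Dqe cqe cpe [qe0 pe0] dqpe].
pose rho := eps * K.
have rho0 : 0 <= rho by apply: mulr_ge0; exact: ltW.
have rhor : rho * expR (C * T) < r.
  by rewrite /rho -mulrA -ltr_pdivlMr// mulr_gt0.
pose phi t := dotm (qe t - q t) (qe t - q t) + dotm (pe t - p t) (pe t - p t).
have cphi : continuous phi.
  move=> t; have c1 := continuousB (cqe t) (cq t).
  have c2 := continuousB (cpe t) (cp t).
  exact: continuousD (continuous_dotm c1 c1) (continuous_dotm c2 c2).
have phiE t : phi t = enorm (qe t - q t) ^+ 2 + enorm (pe t - p t) ^+ 2.
  by rewrite /phi !enorm_sqr.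
have phi_lt t : phi t < r ^+ 2 -> enorm (qe t - q t) < r /\ enorm (pe t - p t) < r.
  rewrite phiE => phir; split; rewrite -(@ltr_pXn2r _ 2) ?nnegrE ?enorm_ge0 ?(ltW r_gt0)//.
    by apply: le_lt_trans phir; rewrite lerDl sqr_ge0.
  by apply: le_lt_trans phir; rewrite lerDr sqr_ge0.
suff H : forall t, 0 <= t <= T -> phi t < r ^+ 2.
  by move=> t /H /phi_lt[]; lra.
apply: continuous_induction => // tau /andP[tau0 tauT] phir.
pose dv t := rowmap (@relvel R eps d) (pe t) - p t.
pose df t := - dv t - (F (qe t) - F (q t)).
(* Adding the squared velocity error makes the differential inequality homogeneous, and [psi] starts
   at [rho ^+ 2]. *)
pose psi t := phi t + rho ^+ 2.
pose dpsi t := 2 * dotm (qe t - q t) (dv t) + 2 * dotm (pe t - p t) (df t).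
have lang t : rowmap (@langvel R d) (p t) = p t by apply/matrixP => i k; rewrite !mxE.
have dpsiP (t : R) : 0 < t < tau -> is_derive t 1 psi (dpsi t).
  move=> /andP[t0 _]; have [dq1 dp1] := dqp t t0; have [dq2 dp2] := dqpe t t0.
  have dq : is_derive t 1 (qe - q) (dv t).
    by apply: is_derive_eq; rewrite lang.
  have dp : is_derive t 1 (pe - p) (df t).
    have -> : pe - p = (pe - (fun s => Num.sqrt 2 *: w s)) - (p - (fun s => Num.sqrt 2 *: w s)).
      by apply/funext => s; apply/matrixP => i k; rewrite !fctE !mxE; ring.
    apply: is_derive_eq; rewrite lang /df /dv.
    by apply/matrixP => i k; rewrite !mxE; ring.
  have H1 := is_derive_dotm dq dq; have H2 := is_derive_dotm dp dp.
  have : is_derive t 1 ((fun s => dotm ((qe - q) s) ((qe - q) s)) +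
     (fun s => dotm ((pe - p) s) ((pe - p) s)) + cst (rho ^+ 2)) (dpsi t).
    apply: is_derive_eq; rewrite /dpsi !fctE/= addr0 (dotmC (dv t)) (dotmC (df t)).
    by rewrite !mulr_natl !mulr2n.
  by [].
have dpsi_le t : 0 < t < tau -> dpsi t <= C * psi t.
  move=> /andP[t0 ttau].
  have tT : 0 <= t <= T by rewrite (ltW t0)/= (le_trans (ltW ttau)).
  have [qr pr] := phi_lt t (phir t ltac:(by rewrite (ltW t0) ttau)).
  have dF := FL t tT (qe t) (le_trans (ltW qr) rr0).
  have dvle : enorm (dv t) <= enorm (pe t - p t) + rho.
    rewrite /dv -(subrKA (pe t)) addrC (le_trans (enormD _ _))// lerD2l.
    rewrite (le_trans (rowmap_relvel_sub_id _ (ltW eps0)))// /rho mulrCA.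
    rewrite ler_wpM2l ?(ltW eps0)// /K (@le_trans _ _ ((n * d)%:R * (B + 1) ^+ 3))//.
      rewrite ler_wpM2l// lerXn2r ?nnegrE ?enorm_ge0 ?addr_ge0//.
      rewrite -(subrK (p t) (pe t)) (le_trans (enormD _ _))// addrC lerD ?pB//.
      by rewrite (le_trans (ltW pr)).
    by rewrite lerDl.
  have dfle : enorm (df t) <= enorm (dv t) + L * enorm (qe t - q t).
    by rewrite (le_trans (enormB _ _))// enormN lerD2l.
  have h1 := dotm_le (qe t - q t) (dv t).
  have h2 := dotm_le (pe t - p t) (df t).
  rewrite /dpsi /psi phiE /C.
  have := enorm_ge0 (qe t - q t); have := enorm_ge0 (pe t - p t).
  move: h1 h2 dfle dvle.
  set a := enorm (qe t - q t); set b := enorm (pe t - p t).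
  set x := dotm _ _; set y := dotm _ _; set u := enorm (dv t); set v := enorm (df t).
  move=> xle yle vle ule b0 a0.
  have h3 : x <= a * (b + rho) by rewrite (le_trans xle)// ler_wpM2l.
  have h4 : y <= b * (b + rho + L * a).
    by rewrite (le_trans yle)// ler_wpM2l// (le_trans vle)// lerD2r.
  have h5 : L * (2 * (a * b)) <= L * (a ^+ 2 + b ^+ 2).
    by rewrite ler_wpM2l//; have := sqr_ge0 (a - b); rewrite sqrrB; lra.
  have h6 := sqr_ge0 (a - b); have h7 := sqr_ge0 (a - rho); have h8 := sqr_ge0 (b - rho).
  have h9 : 0 <= L * rho ^+ 2 by rewrite mulr_ge0// sqr_ge0.
  nra.
have cpsi : continuous psi by move=> t; apply: cvgD; [exact: cphi|exact: cvg_cst].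
have := gronwall cpsi dpsiP dpsi_le (t := tau); rewrite tau0 lexx => /(_ isT).
rewrite /psi {2}/phi qe0 pe0 q00 p00 !subrr -!enorm_sqr !enorm0 expr0n/= !add0r => H.
have : rho ^+ 2 * expR (C * tau) <= rho ^+ 2 * expR (C * T) ^+ 2.
  rewrite ler_wpM2l ?sqr_ge0//.
  rewrite -expRM_natl ler_expR; have : 0 <= C by rewrite /C; lra.
  by move=> C0; have := ler_wpM2l C0 tauT; have := mulr_ge0 C0 (ltW T0); lra.
rewrite -exprMn => H2.
have : (rho * expR (C * T)) ^+ 2 < r ^+ 2.
  by rewrite ltr_pXn2r// ?nnegrE ?mulr_ge0 ?ltW.
have := sqr_ge0 rho; lra.
Qed.

End comparison.

(** * Growth of the potentials *)

Section powR_bounds.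
Context {R : realType}.

Lemma powR_le1D (x a b : R) : 0 <= x -> 0 <= a <= b -> x `^ a <= 1 + x `^ b.
Proof.
move=> x0 /andP[a0 ab]; have [x1|x1] := leP x 1.
  rewrite (@le_trans _ _ 1) ?lerDl ?powR_ge0//.
  by have := ge0_ler_powR a0 _ _ x1; rewrite powR1 !nnegrE => ->.
by rewrite (le_trans (ler_powR (ltW x1) ab))// lerDr.
Qed.

Lemma powRVN (x a : R) : 0 <= x -> (x^-1) `^ a = x `^ (- a).
Proof. by move=> x0; rewrite -powR_inv1// -powRrM mulN1r. Qed.

Lemma powR_absorb (A c a b : R) : 0 <= A -> 0 < c -> 0 <= a < b ->
  exists2 C, 0 <= C & forall u, 0 <= u -> A * u `^ a <= c * u `^ b + C.
Proof.
move=> A0 c0 /andP[a0 ab].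
(* Beyond [(A / c)^(1/(b-a))] the higher power wins; the added 1 makes [u] positive in that case. *)
pose K := (A / c) `^ (b - a)^-1 + 1.
have K1 : 1 <= K by rewrite lerDr powR_ge0.
have K0 : 0 <= K by rewrite (le_trans ler01).
exists (A * K `^ a); first by rewrite mulr_ge0 ?powR_ge0.
move=> u u0; have [uK|Ku] := leP u K.
  rewrite ler_wpDl ?mulr_ge0 ?powR_ge0// ?(ltW c0)// ler_wpM2l//.
  exact: ge0_ler_powR.
rewrite ler_wpDr ?mulr_ge0 ?powR_ge0//.
have u_gt0 : 0 < u by rewrite (lt_trans _ Ku)// (lt_le_trans ltr01).
have -> : u `^ b = u `^ a * u `^ (b - a).
  by rewrite -powRD ?subrKC// (gt_eqF u_gt0) implybT.
rewrite mulrCA mulrC ler_wpM2l ?powR_ge0//.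
rewrite -ler_pdivrMl// mulrC (@le_trans _ _ (K `^ (b - a)))//; last first.
  apply: ge0_ler_powR; rewrite ?nnegrE//; last exact: ltW.
  by rewrite subr_ge0 ltW.
have Ac0 : 0 <= A / c by rewrite divr_ge0// ltW.
have -> : A / c = ((A / c) `^ (b - a)^-1) `^ (b - a).
  by rewrite -powRrM mulVf ?powRr1// subr_eq0 gt_eqF.
apply: ge0_ler_powR; rewrite ?nnegrE ?subr_ge0 ?powR_ge0 ?(ltW ab)//.
by rewrite /K lerDl.
Qed.

End powR_bounds.

Section potentials.
Context {R : realType} {d : nat} (U G : 'rV[R]_d -> R).
Hypothesis (AU : AssumptionU U) (AG : AssumptionG1 G).

Lemma grad_U_le : exists2 C, 0 <= C & forall q, enorm (grad U q) <= C * U q.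
Proof.
have [_ [U1 [a1 [l [a2 [a3 [a10 l1 _ _ H]]]]]]] := AU.
have aa0 := mulr_ge0 (ltW a10) (ltW a10).
exists (a1 * (2 + a1 + a1 * a1)).
  by rewrite mulr_ge0 ?ltW// !addr_gt0// mulr_gt0.
move=> q; have [h1 _ h3 _] := H q.
have Uq := U1 q; have U0 := lt_le_trans ltr01 Uq.
rewrite (le_trans h3)// -mulrA ler_wpM2l ?(ltW a10)//.
have : enorm q `^ l <= 1 + enorm q `^ (l + 1).
  by rewrite powR_le1D ?enorm_ge0//; lra.
have : enorm q `^ (l + 1) <= a1 * (U q + a1).
  by rewrite -ler_pdivrMl// -lerBlDr; move: h1; rewrite gtr0_norm.
nra.
Qed.

Lemma enorm_le_U : exists2 C, 0 <= C & forall q, enorm q <= C * U q.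
Proof.
have [_ [U1 [a1 [l [a2 [a3 [a10 l1 _ _ H]]]]]]] := AU.
have aa0 := mulr_ge0 (ltW a10) (ltW a10).
exists (1 + a1 + a1 * a1); first by rewrite !addr_ge0// ltW.
move=> q; have [h1 _ _ _] := H q.
have Uq := U1 q; have U0 := lt_le_trans ltr01 Uq.
have : enorm q <= 1 + enorm q `^ (l + 1).
  by rewrite -{1}(powRr1 (enorm_ge0 q)) powR_le1D ?enorm_ge0//; lra.
have : enorm q `^ (l + 1) <= a1 * (U q + a1).
  by rewrite -ler_pdivrMl// -lerBlDr; move: h1; rewrite gtr0_norm.
nra.
Qed.

(** Near the origin [G] is positive. Away from it [G] grows at most linearly in absolute value,
    while [U] grows at least quadratically since [lam + 1 >= 2]. Half of [U] thus pays for the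
    negative part of [G], and the energy keeps the other half. *)
Lemma G_lower_bound : exists2 C, 0 <= C & forall q, q != 0 ->
  - (U q / 2) - C <= G q.
Proof.
have [_ [U1 [c1 [l [a2 [a3 [c10 l1 _ _ H]]]]]]] := AU.
have [_ Goo _ _ [a1 [b1 [b2 [a4 [a5 [a6 [[a10 b11] _ _ _ HG]]]]]]]] := AG.
have /nbhs_ballP[r /= r0 rG] : nbhs (0 : 'rV[R]_d) (fun q => q != 0 -> 0 < G q).
  exact: Goo 0.
pose C := a1 * (1 + r `^ (- b1)) + c1 * a1 ^+ 2 / 2 + (c1^-1 + c1) / 2.
have C0 : 0 <= C.
  rewrite /C !addr_ge0 ?mulr_ge0 ?addr_ge0 ?invr_ge0 ?powR_ge0 ?sqr_ge0//; exact: ltW.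
exists C => // q q0; have Uq := U1 q; have U0 := lt_le_trans ltr01 Uq.
have [qr|rq] := ltP `|q| r.
  have := rG q; rewrite -ball_normE /= sub0r normrN => /(_ qr q0).
  have : 0 <= U q / 2 by rewrite divr_ge0// ltW.
  lra.
have rq' : r <= enorm q by exact: le_trans (mxnorm_le_enorm _).
have [hG _ _] := HG q q0; have [h1 _ _ _] := H q.
have h2 : enorm q ^+ 2 <= 1 + enorm q `^ (l + 1).
  by rewrite -powR_mulrn ?enorm_ge0// powR_le1D ?enorm_ge0//; lra.
have h3 : enorm q `^ (l + 1) <= c1 * (U q + c1).
  by rewrite -ler_pdivrMl// -lerBlDr; move: h1; rewrite gtr0_norm.
have h4 : enorm q `^ (- b1) <= r `^ (- b1).
  rewrite !powRN lef_pV2 ?posrE ?powR_gt0 ?enorm_gt0//.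
  by apply: ge0_ler_powR; rewrite ?nnegrE ?enorm_ge0 ?(ltW r0)// (le_trans _ b11).
have h5 : a1 * enorm q <= enorm q ^+ 2 / (2 * c1) + c1 * a1 ^+ 2 / 2.
  rewrite -subr_ge0 (_ : _ - _ = (enorm q - c1 * a1) ^+ 2 / (2 * c1)).
    by rewrite divr_ge0 ?sqr_ge0// mulr_ge0// ltW.
  by field; rewrite gt_eqF.
have h6 : enorm q ^+ 2 / (2 * c1) <= U q / 2 + (c1^-1 + c1) / 2.
  rewrite ler_pdivrMr ?mulr_gt0//.
  have -> : (U q / 2 + (c1^-1 + c1) / 2) * (2 * c1) = 1 + c1 * (U q + c1).
    by field; rewrite gt_eqF.
  by rewrite (le_trans h2)// lerD2l.
have h7 : a1 * enorm q `^ (- b1) <= a1 * r `^ (- b1) by rewrite ler_wpM2l// ltW.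
have h8 : - `|G q| <= G q by have := ler_norm (- G q); rewrite normrN; lra.
rewrite /C; nra.
Qed.

(** The leading singular term gives [- dotm (grad G q) q] the size [a4 |q|^(1-b1)], which controls
    [|grad G| |q|] up to a multiple of |q|. As [b1 >= 1], there is also room for the constant
    [dl ^+ 2], which will absorb the transverse error of the radial rate. *)
Lemma grad_G_impulse : exists C1 C2 dl : R, [/\ 0 <= C1, 0 <= C2, 0 < dl &
  forall q, q != 0 -> enorm (grad G q) * enorm q <=
    C1 * (- dotm (grad G q) q - dl ^+ 2 + C2 * enorm q)].
Proof.
have [_ _ _ _ [a1 [b1 [b2 [a4 [a5 [a6 [[a10 b11] [b20 b21] a40 a60 HG]]]]]]]] := AG.
have c0 : 0 < a4 / 4 by rewrite divr_gt0.
have [C C0 HC] := @powR_absorb R `|a5| _ _ _ (normr_ge0 a5) c0 (introT andP (conj b20 b21)).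
pose dl := Num.sqrt (a4 / 4).
have dlE : dl ^+ 2 = a4 / 4 by rewrite sqr_sqrtr// ltW.
exists (2 * a1 / a4), (C + a6 + a4 / 4 + a4 / 2), dl; split.
- by rewrite divr_ge0 ?mulr_ge0// ltW.
- by move: a40 a60 C0; lra.
- by rewrite sqrtr_gt0.
move=> q q0; have [_ h1 h2] := HG q q0.
have x0 : 0 < enorm q by rewrite enorm_gt0.
move: h1 h2; set x := enorm q => h1 h2.
rewrite dlE.
have u0 : 0 <= x^-1 by rewrite invr_ge0 ltW.
have k1 := HC _ u0; rewrite !powRVN ?(ltW x0)// in k1.
have k2 : x^-1 <= 1 + x `^ (- b1).
  rewrite -powRVN ?(ltW x0)// -{1}(powRr1 u0) powR_le1D//; lra.
have pE b : x ^+ 2 / x `^ (b + 1) = x * x `^ (- b).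
  have xb0 : x `^ b != 0 by rewrite gt_eqF// powR_gt0.
  rewrite powRD ?(gt_eqF x0) ?implybT// powRr1 ?(ltW x0)// powRN; field.
  by rewrite ?xb0 ?(gt_eqF x0).
have k3 : dotm (grad G q) q + a4 * (x * x `^ (- b1)) + a5 * (x * x `^ (- b2)) <= a6 * x.
  have xx : dotm q q = x ^+ 2 by rewrite /x enorm_sqr.
  rewrite (_ : _ + _ = dotm (grad G q + (a4 / x `^ (b1 + 1)) *: q
                          + (a5 / x `^ (b2 + 1)) *: q) q); last first.
    by rewrite !dotmDl !dotmZl xx -!pE; ring.
  by rewrite (le_trans (dotm_le _ _))// ler_wpM2r// ltW.
have k4 : - (`|a5| * x `^ (- b2)) * x <= a5 * (x * x `^ (- b2)).
  have : - `|a5| <= a5 by have := ler_norm (- a5); rewrite normrN; lra.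
  have : 0 <= x * x `^ (- b2) by rewrite mulr_ge0 ?powR_ge0// ltW.
  nra.
move: k1 k2 k3 k4 h1; set P := x `^ (- b1); set Q := x `^ (- b2).
set D := dotm _ _ => k1 k2 k3 k4 h1.
have m1 : `|a5| * Q * x <= (a4 / 4 * P + C) * x by rewrite ler_wpM2r// ltW.
have m2 : 1 <= (1 + P) * x by rewrite -ler_pdivrMr// mul1r.
have m3 : a4 / 4 <= a4 / 4 * ((1 + P) * x) by rewrite ler_peMr// ltW.
(* Of the coefficient [a4] of [P * x], a quarter pays for the [a5] term, whose sign is free, and a
   quarter for [dl ^+ 2] through [m3]. The remaining half is the origin of [2 / a4] in the first
   witness. *)
have m4 : a4 / 2 * ((1 + P) * x) <= - D - a4 / 4 + (C + a6 + a4 / 4 + a4 / 2) * x.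
  nra.
have m5 : enorm (grad G q) * x <= a1 * ((1 + P) * x).
  by rewrite mulrA ler_wpM2r// ltW.
rewrite (le_trans m5)//.
have -> : a1 * ((1 + P) * x) = 2 * a1 / a4 * (a4 / 2 * ((1 + P) * x)).
  by field; rewrite gt_eqF.
by rewrite ler_wpM2l// divr_ge0 ?mulr_ge0 ?ltW.
Qed.

End potentials.

(** * Relativistic kinetic energy *)

Section kinetic.
Context {R : realType} {d : nat}.
Implicit Types (p y q z : 'rV[R]_d) (eps : R).

Definition lorentz eps y : R := Num.sqrt (1 + eps * enorm y ^+ 2).

(* Equals (lorentz eps y - 1) / eps when eps <> 0, and |y|^2 / 2 when eps = 0. *)
Definition kin eps y : R := enorm y ^+ 2 / (1 + lorentz eps y).

Lemma lorentz_sqr eps y : 0 <= eps ->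
  lorentz eps y ^+ 2 = 1 + eps * enorm y ^+ 2.
Proof. by move=> e0; rewrite sqr_sqrtr// addr_ge0// mulr_ge0 ?sqr_ge0. Qed.

Lemma kin_ge0 eps y : 0 <= kin eps y.
Proof. by rewrite divr_ge0 ?sqr_ge0// addr_ge0// sqrtr_ge0. Qed.

Lemma kinM eps y : kin eps y * (1 + lorentz eps y) = enorm y ^+ 2.
Proof. by rewrite divfK// gt_eqF// ltr_pwDl// sqrtr_ge0. Qed.

Lemma kin_le eps y : 0 <= eps -> kin eps y <= enorm y ^+ 2.
Proof.
move=> e0; rewrite -(kinM eps) ler_peMr ?kin_ge0// lerDl.
by rewrite sqrtr_ge0.
Qed.

Lemma relvel_sqr_le eps y : 0 <= eps ->
  enorm (relvel eps y) ^+ 2 <= 2 * kin eps y.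
Proof.
move=> e0; rewrite /relvel enormZ exprMn -/(lorentz eps y).
have g1 : 1 <= lorentz eps y := relvel_gamma_ge1 y e0.
have g0 := lt_le_trans ltr01 g1.
rewrite ger0_norm ?invr_ge0 ?(ltW g0)// -(kinM eps) exprVn mulrC.
rewrite ler_pdivrMr ?exprn_gt0//.
have h : 0 <= 2 * lorentz eps y ^+ 2 - (1 + lorentz eps y) by nra.
by have := mulr_ge0 (kin_ge0 eps y) h; lra.
Qed.

(** For [eps > 0] the kinetic energy grows only linearly, with slope of order [eps^(-1/2)]; the
    condition on [th] makes this slope steep enough. It is used in the form [th g <= th + |y| / 4],
    with g the Lorentz factor. *)
Lemma enorm_le_kin eps (th : R) y : 0 <= eps -> 0 <= th -> 16 * th ^+ 2 * eps <= 1 ->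
  th * enorm y <= kin eps y / 2 + 4 * th ^+ 2.
Proof.
move=> e0 th0 the.
have g1 : 1 <= lorentz eps y := relvel_gamma_ge1 y e0.
have g2 := lorentz_sqr y e0.
have P0 := enorm_ge0 y.
have g0 : 0 < 1 + lorentz eps y by rewrite ltr_pwDl// (le_trans ler01).
rewrite -(ler_pM2r g0).
have -> : (kin eps y / 2 + 4 * th ^+ 2) * (1 + lorentz eps y) =
    enorm y ^+ 2 / 2 + 4 * th ^+ 2 * (1 + lorentz eps y).
  by rewrite -(kinM eps y); ring.
move: g1 g2 P0 g0; set P := enorm y; set g := lorentz eps y => g1 g2 P0 g0.
have h : th * g <= th + P / 4.
  have gge0 : 0 <= g by lra.
  rewrite -(@ler_pXn2r _ 2)// ?nnegrE ?mulr_ge0 ?addr_ge0 ?divr_ge0//.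
  rewrite exprMn g2 sqrrD.
  have : 16 * th ^+ 2 * eps * P ^+ 2 <= 1 * P ^+ 2 by rewrite ler_wpM2r ?sqr_ge0.
  have : 0 <= th * P by rewrite mulr_ge0.
  rewrite exprMn; lra.
have : th * g * P <= (th + P / 4) * P by exact: (ler_wpM2r P0 h).
have : 0 <= (P / 2 - 2 * th) ^+ 2 by rewrite sqr_ge0.
have gge0 : 0 <= g by lra.
have : 0 <= th ^+ 2 * g by rewrite mulr_ge0 ?sqr_ge0.
nra.
Qed.

(** Let [|p| <= |y|] and let [a >= b] be the inverse Lorentz factors of p and y. Then
    [a p - b y = b (p - y) + (a - b) p]. Speed increases with momentum, so [a |p| <= b |y|] and the
    last term is at most [b (|y| - |p|)]. The constant is uniform in eps. *)
Lemma relvel_lipschitz eps p y : 0 <= eps ->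
  enorm (relvel eps p - relvel eps y) <= 2 * enorm (p - y).
Proof.
move=> e0; wlog py : p y / enorm p <= enorm y.
  move=> H; have [|/ltW] := leP (enorm p) (enorm y); first exact: H.
  by move=> /H; rewrite enormB_sym (enormB_sym y).
rewrite /relvel -/(lorentz eps p) -/(lorentz eps y).
have gp : 1 <= lorentz eps p := relvel_gamma_ge1 p e0.
have gy : 1 <= lorentz eps y := relvel_gamma_ge1 y e0.
have gp0 := lt_le_trans ltr01 gp; have gy0 := lt_le_trans ltr01 gy.
set a := (lorentz eps p)^-1; set b := (lorentz eps y)^-1.
have P0 := enorm_ge0 p; have Y0 := enorm_ge0 y.
have PY2 : enorm p ^+ 2 <= enorm y ^+ 2 by rewrite lerXn2r.
have gpy : lorentz eps p <= lorentz eps y.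
  by rewrite ler_wsqrtr// lerD2l ler_wpM2l.
have ba : b <= a by rewrite lef_pV2.
have b0 : 0 <= b by rewrite invr_ge0 ltW.
have b1 : b <= 1 by rewrite invf_le1.
have apby : a * enorm p <= b * enorm y.
  rewrite ler_pdivrMl// mulrCA ler_pdivlMl//.
  rewrite -(@ler_pXn2r _ 2)// ?nnegrE ?mulr_ge0 ?(ltW gp0) ?(ltW gy0)// !exprMn !lorentz_sqr//.
  nra.
rewrite (_ : a *: p - b *: y = b *: (p - y) + (a - b) *: p); last first.
  by apply/matrixP => i k; rewrite !mxE; ring.
rewrite (le_trans (enormD _ _))// !enormZ ger0_norm// ger0_norm ?subr_ge0//.
have := enormD (y - p) p; rewrite subrK (enormB_sym y) => tri.
have : b * enorm (p - y) <= enorm (p - y) by rewrite ler_piMl ?enorm_ge0.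
have : b * enorm y <= b * (enorm (p - y) + enorm p) by rewrite ler_wpM2l.
lra.
Qed.

(** The velocity is the gradient of [kin]. As a function of [x = |y|^2], [kin] has derivative
    [1 / (2 h x)], a form that includes eps = 0. *)
Lemma is_derive_kin eps (y : R -> 'rV[R]_d) (t : R) (y' : 'rV[R]_d) : 0 <= eps ->
  is_derive t 1 y y' ->
  is_derive t 1 (fun s => kin eps (y s)) (dotm (relvel eps (y t)) y').
Proof.
move=> e0 dy.
have dn := is_derive_dotm dy dy.
pose N s := dotm (y s) (y s).
pose h (x : R) := Num.sqrt (1 + eps * x).
have N0 : 0 <= N t by exact: dotm_ge0.
have hx : 0 < 1 + eps * N t by rewrite ltr_pwDl// mulr_ge0.
have h1 : 1 <= h (N t) by rewrite -[leLHS]sqrtr1 ler_wsqrtr// lerDl mulr_ge0.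
have h0 := lt_le_trans ltr01 h1.
have h2 : h (N t) ^+ 2 = 1 + eps * N t by rewrite sqr_sqrtr// ltW.
have dl : is_derive (N t) 1 (fun x : R => 1 + eps * x) eps.
  have : is_derive (N t) 1 (cst 1 + eps *: (id : R -> R)) eps.
    by apply: is_derive_eq; rewrite add0r /GRing.scale/= mulr1.
  by [].
have dsq : is_derive (N t) 1 h (eps / (2 * h (N t))).
  have := is_derive1_sqrt hx => ds.
  have := @is_derive1_comp R (@Num.sqrt R) (fun x : R => 1 + eps * x) (N t) _ _ ds dl.
  by move=> H; apply: is_derive_eq; rewrite -/(h (N t)) mulrC.
have dk : is_derive (N t) 1 (fun x => x * (1 + h x)^-1) ((2 * h (N t))^-1).
  have d1 : is_derive (N t) 1 (fun x => 1 + h x) (eps / (2 * h (N t))).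
    have : is_derive (N t) 1 (cst 1 + h) (eps / (2 * h (N t))).
      by apply: is_derive_eq; rewrite add0r.
    by [].
  have nz : 1 + h (N t) != 0 by rewrite gt_eqF// ltr_pwDl// ltW.
  have d2 := @is_deriveV R (fun x => 1 + h x) (N t) _ _ nz d1.
  have : is_derive (N t) 1 ((id : R -> R) * (fun x => (1 + h x)^-1)) ((2 * h (N t))^-1).
    apply: (is_derive_eq (is_deriveM _ d2)).
    rewrite /GRing.scale/= mulr1.
    have -> : N t * (- (1 + h (N t)) ^- 2 * (eps / (2 * h (N t)))) =
      - ((eps * N t) * ((1 + h (N t)) ^- 2 / (2 * h (N t)))) by ring.
    have -> : eps * N t = h (N t) ^+ 2 - 1 by rewrite h2 addrC addKr.
    by field; rewrite nz gt_eqF.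
  by [].
have := @is_derive1_comp R (fun x => x * (1 + h x)^-1) N t _ _ dk dn.
have -> : (fun x => x * (1 + h x)^-1) \o N = (fun s => kin eps (y s)).
  by apply/funext => s; rewrite /= /kin /lorentz enorm_sqr.
move=> H; apply: is_derive_eq.
rewrite /relvel dotmZl enorm_sqr -/(N t) -/(h (N t)) (dotmC y') -mulr2n.
rewrite -mulr_natl; field; by rewrite gt_eqF.
Qed.

(* The component of z orthogonal to q completes the square. *)
Lemma transverse_ge (a : R) p q z : 0 <= a <= 1 -> q != 0 ->
  - (enorm z ^+ 2 / 4) <=
  a * dotm (p - z) p - dotm (p - z) q * (a * dotm q p) / enorm q ^+ 2.
Proof.
move=> /andP[a0 a1] q0; have n0 : 0 < dotm q q by rewrite -enorm_sqr exprn_gt0// enorm_gt0.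
pose u := p - 2^-1 *: z.
have key x : 0 <= dotm x x - dotm x q ^+ 2 / dotm q q.
  rewrite subr_ge0 ler_pdivrMr// -!enorm_sqr -exprMn.
  have := cauchy_schwarz x q.
  by rewrite -(@ler_pXn2r _ 2)// ?nnegrE ?mulr_ge0 ?enorm_ge0// -normrX ger0_norm ?sqr_ge0.
have k1 := key u; rewrite !enorm_sqr.
have E : a * dotm (p - z) p - dotm (p - z) q * (a * dotm q p) / dotm q q =
   a * (dotm u u - dotm u q ^+ 2 / dotm q q)
   - a / 4 * (dotm z z - dotm z q ^+ 2 / dotm q q).
  rewrite /u !dotmBl !dotmBr !dotmZl !dotmZr (dotmC q p) (dotmC z p); field.
  by rewrite gt_eqF.
rewrite E.
have z1 : dotm z z - dotm z q ^+ 2 / dotm q q <= dotm z z.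
  by rewrite gerDl oppr_le0 divr_ge0 ?sqr_ge0// ltW.
have := dotm_ge0 z; have := mulr_ge0 a0 k1; have := key z; nra.
Qed.

End kinetic.

(** * A priori bound *)

Section energy_rates.
Context {R : realType} {d : nat}.
Implicit Types (p q y f g gU gG vp vy : 'rV[R]_d) (dl eps : R).

(** If [vp = vy], the force cancels and friction only dissipates. In general [vp - vy] is left
    paired with [vp] and with [g]; the friction [- |vp|^2] absorbs the first pairing at the cost of
    [dl ^+ 2]. *)
Lemma energy_rate_le vp vy f g dl : enorm (vp - vy) <= 2 * dl ->
  dotm vy (- vp - g + f) + dotm g vp <=
  dl ^+ 2 + 2 * dl * enorm g + enorm vy * enorm f.
Proof.
move=> vdl.
have -> : dotm vy (- vp - g + f) + dotm g vp =
   - dotm vp vp + dotm (vp - vy) vp + dotm g (vp - vy) + dotm vy f.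
  by rewrite !dotmE (dotmC vy g); ring.
have h1 := dotm_le (vp - vy) vp; have h2 := dotm_le g (vp - vy).
have h3 := dotm_le vy f; rewrite -enorm_sqr.
have h4 : enorm (vp - vy) * enorm vp <= 2 * dl * enorm vp by rewrite ler_wpM2r ?enorm_ge0.
have h5 : enorm g * enorm (vp - vy) <= enorm g * (2 * dl) by rewrite ler_wpM2l ?enorm_ge0.
have := sqr_ge0 (enorm vp - dl); rewrite sqrrB; lra.
Qed.

(** The right side is |q| times the rate of the radial momentum. For [y = p] its last two terms form
    the centrifugal contribution, which is nonnegative; moving y away from p by [dl] costs at most
    [dl ^+ 2 / 4]. *)
Lemma radial_rate_ge eps p q y f gU gG dl : 0 <= eps -> q != 0 ->
  enorm (p - y) <= dl ->
  - enorm q * (enorm (relvel eps p) + enorm gU + enorm f) - dotm gG q - dl ^+ 2 / 4 <=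
  dotm (- relvel eps p - (gU + gG) + f) q + dotm y (relvel eps p)
    - dotm y q * dotm q (relvel eps p) / enorm q ^+ 2.
Proof.
move=> e0 q0 ydl.
have g1 := relvel_gamma_ge1 p e0.
have g0 := lt_le_trans ltr01 g1.
have a01 : 0 <= (Num.sqrt (1 + eps * enorm p ^+ 2))^-1 <= 1.
  by rewrite invr_ge0 (ltW g0) invf_le1.
have := @transverse_ge R d _ p q (p - y) a01 q0.
rewrite subKr -!dotmZr -/(relvel eps p) => h1.
have h2 : enorm (p - y) ^+ 2 <= dl ^+ 2.
  by rewrite lerXn2r ?nnegrE ?enorm_ge0// (le_trans _ ydl)// enorm_ge0.
have h3 := dotm_le (relvel eps p) q.
have h4 := dotm_le gU q.
have h5 := dotm_ge f q.
rewrite !dotmDl !dotmNl dotmDl; lra.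
Qed.

End energy_rates.

Section path_functionals.
Context {R : realType} {d : nat}.

Lemma is_derive_enorm (q : R -> 'rV[R]_d) (t : R) q' : q t != 0 ->
  is_derive t 1 q q' ->
  is_derive t 1 (fun s => enorm (q s)) (dotm (q t) q' / enorm (q t)).
Proof.
move=> q0 dq; have dn := is_derive_dotm dq dq.
have n0 : 0 < dotm (q t) (q t) by rewrite -enorm_sqr exprn_gt0// enorm_gt0.
have e0 : enorm (q t) != 0 by rewrite enorm_eq0.
have ds := is_derive1_sqrt n0.
have := @is_derive1_comp R (@Num.sqrt R) (fun s => dotm (q s) (q s)) t _ _ ds dn.
have -> : @Num.sqrt R \o (fun s => dotm (q s) (q s)) = (fun s => enorm (q s)).
  by apply/funext => s; rewrite /= enormE.
move=> H; apply: is_derive_eq; rewrite -enormE (dotmC q').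
by field.
Qed.

Lemma is_derive_radial (y q : R -> 'rV[R]_d) (t : R) y' q' : q t != 0 ->
  is_derive t 1 y y' -> is_derive t 1 q q' ->
  is_derive t 1 (fun s => dotm (y s) (q s) / enorm (q s))
    ((dotm y' (q t) + dotm (y t) q' - dotm (y t) (q t) * dotm (q t) q' / enorm (q t) ^+ 2)
     / enorm (q t)).
Proof.
move=> q0 dy dq; have dn := is_derive_dotm dy dq.
have de := is_derive_enorm q0 dq.
have e0 : enorm (q t) != 0 by rewrite enorm_eq0.
have di := @is_deriveV R (fun s => enorm (q s)) t _ _ e0 de.
have := is_deriveM dn di => H.
apply: (is_derive_eq H); rewrite /GRing.scale/=; field.
exact: e0.
Qed.

Lemma continuous_kin (eps : R) (y : R -> 'rV[R]_d) : 0 <= eps ->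
  continuous y -> continuous (fun s => kin eps (y s)).
Proof.
move=> e0 cy t.
have c1 : {for t, continuous (fun s => enorm (y s) ^+ 2)}.
  have c := continuous_enorm (cy t).
  exact: (continuousM c c).
have c2 : {for t, continuous (fun s => 1 + eps * enorm (y s) ^+ 2)}.
  by apply: cvgD; [exact: cvg_cst|apply: cvgM; [exact: cvg_cst|exact: c1]].
have c3 := continuous_comp c2 (@sqrt_continuous R _).
have c4 : {for t, continuous (fun s => 1 + lorentz eps (y s))}.
  by apply: cvgD; [exact: cvg_cst|exact: c3].
apply: (continuousM c1); apply: (continuousV _ c4).
by rewrite gt_eqF// ltr_pwDl// sqrtr_ge0.
Qed.

Lemma continuous_radial (y q : R -> 'rV[R]_d) : (forall t, q t != 0) ->
  continuous y -> continuous q ->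
  continuous (fun s => dotm (y s) (q s) / enorm (q s)).
Proof.
move=> q0 cy cq t.
apply: (continuousM (continuous_dotm (cy t) (cq t))).
by apply: (continuousV _ (continuous_enorm (cq t))); rewrite enorm_eq0.
Qed.

Lemma radial_le (y q : 'rV[R]_d) : q != 0 -> `|dotm y q / enorm q| <= enorm y.
Proof.
move=> q0; rewrite normrM normfV (ger0_norm (enorm_ge0 q)).
by rewrite ler_pdivrMr ?enorm_gt0// cauchy_schwarz.
Qed.

End path_functionals.

Section scalar_rates.
Context {R : realType}.

(** The real-number core of the energy estimate: [K] and [u] stand for kinetic energy and confining
    potential, [vy] and [vp] for speeds, [gU], [gG], [g] for norms of gradients, [f] for the noise
    rate, [dE] and [dR] for the rates of energy and radial momentum. With [th = 2 dl C1], the term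
    [th * dR] cancels against the bound for [2 dl gG]. *)
Lemma lyapunov_rate_le (dl C1 C2 C3 eta M E K u vy vp gU gG g f dE dR th : R) :
  th = 2 * dl * C1 -> 0 < eta -> 0 <= dl -> 0 <= C1 -> 0 <= C2 -> 0 <= C3 -> 0 <= M ->
  0 <= vy -> 0 <= K -> 1 <= u -> K + u / 2 <= E ->
  dE <= dl ^+ 2 + 2 * dl * g + vy * f -> g <= gU + gG ->
  gG <= C1 * (dR + vp + gU + f + C2) ->
  gU <= C3 * u -> vp <= vy + 2 * dl -> vy ^+ 2 <= 2 * K -> f <= dl * M ->
  dE - th * dR <= (2 * dl ^+ 2 + 4 * dl * C3 + th * (1 + 4 * dl + 2 * C3 + 2 * C2)
     + eta * M) * E + M * (dl ^+ 2 / (2 * eta) + th * dl).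
Proof.
move=> thE eta0 dl0 C10 C20 C30 M0 vy0 K0 u1 KuE dEle gle gGle gUle vple vyle fle.
have th0 : 0 <= th by rewrite thE !mulr_ge0.
have E12 : 1 / 2 <= E by move: K0 u1 KuE; clear; lra.
have KE : K + 1 / 2 <= E by move: u1 KuE; clear; lra.
have uE : u <= 2 * E by move: K0 KuE; clear; lra.
have k0 : dE - th * dR <= dl ^+ 2 + 2 * dl * gU + vy * f + th * (vp + gU + f + C2).
  have dl2 : 0 <= 2 * dl by rewrite mulr_ge0.
  have := ler_wpM2l dl2 (le_trans gle (lerD (lexx gU) gGle)).
  by move: dEle; rewrite thE; clear; lra.
have k1 : gU <= 2 * C3 * E.
  by rewrite (le_trans gUle)// -mulrA mulrCA ler_wpM2l.
have k2 : vy <= E.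
  by have := sqr_ge0 (vy - 1); move: vyle KE; rewrite sqrrB expr1n; clear; lra.
have k3 : vp <= (1 + 4 * dl) * E.
  by have := ler_wpM2l dl0 E12; move: k2 vple; clear; lra.
have k4 : C2 <= 2 * C2 * E by have := ler_wpM2l C20 E12; clear; lra.
have k5 : dl ^+ 2 <= 2 * dl ^+ 2 * E.
  by have := ler_wpM2l (sqr_ge0 dl) E12; clear; lra.
(* Young's inequality with weight [eta]: the coefficient of [M * E] becomes as small as desired, and
   the cost falls on the term without [E]. *)
have k6 : vy * f <= M * (eta * E + dl ^+ 2 / (2 * eta)).
  rewrite (@le_trans _ _ (vy * (dl * M)))//; first by rewrite ler_wpM2l.
  rewrite mulrCA mulrA mulrC ler_wpM2l//.
  have j1 : eta * vy ^+ 2 <= eta * (2 * E).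
    by rewrite ler_wpM2l ?(ltW eta0)//; move: vyle KE; clear; lra.
  have j2 : 0 <= (eta * vy - dl) ^+ 2 / (2 * eta).
    by rewrite divr_ge0 ?sqr_ge0// mulr_ge0// ltW.
  have j3 : (eta * vy - dl) ^+ 2 / (2 * eta) =
      eta * vy ^+ 2 / 2 - dl * vy + dl ^+ 2 / (2 * eta).
    by field; rewrite gt_eqF.
  by move: j1 j2; rewrite j3; clear; lra.
have k7 : th * (vp + gU + f + C2) <=
   th * ((1 + 4 * dl + 2 * C3 + 2 * C2) * E + dl * M).
  by rewrite ler_wpM2l//; move: k3 k1 fle k4; clear; lra.
have k8 : 2 * dl * gU <= 2 * dl * (2 * C3 * E) by rewrite ler_wpM2l// mulr_ge0.
by move: k0 k5 k6 k7 k8; clear; lra.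
Qed.

(** The shift of [L] absorbs both the gap between [E] and [2 L] and the inhomogeneous term, written
    as [M * B = 2 (eta M) (B / (2 eta))]. It is independent of [M], which therefore acts only
    through the rate. *)
Lemma lyapunov_rate_close (A eta M B E L t2 : R) :
  0 <= A -> 0 < eta -> 0 <= M -> 0 <= B -> E <= 2 * L + 8 * t2 ->
  (A + eta * M) * E + M * B <= 2 * (A + eta * M) * (L + (4 * t2 + B / (2 * eta))).
Proof.
move=> A0 eta0 M0 B0 EL.
have AM0 : 0 <= A + eta * M by rewrite addr_ge0// mulr_ge0// ltW.
have k1 := ler_wpM2l AM0 EL.
have k2 : M * B = 2 * (eta * M) * (B / (2 * eta)) by field; rewrite gt_eqF.
have k3 : 0 <= A * (B / (2 * eta)).
  by apply: mulr_ge0 => //; apply: divr_ge0 => //; rewrite mulr_ge0// ltW.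
by rewrite k2; move: k1 k3; clear; lra.
Qed.

End scalar_rates.

Section energy.
Context {R : realType} {d : nat} (U G : 'rV[R]_d -> R).
Hypothesis (AU : AssumptionU U) (AG : AssumptionG1 G).

(* The energy kin + U + G alone is not controlled: its rate contains dl * |grad G|, which G does
   not dominate. Subtracting th times the radial momentum cancels this term, because the
   repulsive impulse drives the radial momentum up at least as fast. *)
Lemma energy_bound : exists2 dl : R, 0 < dl & exists2 e0 : R, 0 < e0 &
  forall (T eta : R) (q0 p0 : 'rV[R]_d), 0 < T -> 0 < eta -> q0 != 0 ->
  exists2 C : R, 0 < C &
  forall (eps M : R) (q p y f : R -> 'rV[R]_d), 0 <= eps <= e0 -> 1 <= M ->
  continuous q -> continuous y -> (forall t, q t != 0) ->
  q 0 = q0 -> p 0 = p0 ->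
  (forall t : R, 0 < t < T -> is_derive t 1 q (relvel eps (p t))) ->
  (forall t : R, 0 < t < T ->
    is_derive t 1 y (- relvel eps (p t) - (grad U (q t) + grad G (q t)) + f t)) ->
  (forall t, 0 <= t <= T -> enorm (p t - y t) <= dl) ->
  (forall t, 0 <= t <= T -> enorm (f t) <= dl * M) ->
  forall t, 0 <= t <= T -> enorm (q t) + enorm (p t) <= C * expR (eta * M).
Proof.
have [sU [U1 _]] := AU; have [sG _ _ _ _] := AG.
have dU x : differentiable U x by have [/(_ x) + _] := sU 1%N; exact.
have dG x : x != 0 -> differentiable G x.
  by move=> /eqP x0; have [/(_ x) + _] := sG 1%N; exact.
have [C3 C30 HC3] := grad_U_le AU.
have [C4 C40 HC4] := enorm_le_U AU.
have [C0 C00 HC0] := G_lower_bound AU AG.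
have [C1 [C2 [dl0 [C10 C20 dl00 Himp]]]] := grad_G_impulse AG.
pose dl := Num.min dl0 1.
have dl_gt0 : 0 < dl by rewrite lt_min dl00 ltr01.
have dl_ge0 := ltW dl_gt0.
have dldl0 : dl <= dl0 by rewrite ge_min lexx.
exists dl => //.
pose th := 2 * dl * C1.
have th0 : 0 <= th by rewrite !mulr_ge0.
(* This ensures [16 th^2 eps <= 1] and [16 eps <= 1]: [enorm_le_kin] is applied with weight [th] for
   the radial momentum and with weight 1 for |y|. *)
pose e0 : R := (16 * (1 + th ^+ 2))^-1.
have th1 : 0 < 1 + th ^+ 2 by rewrite ltr_pwDl// sqr_ge0.
have e00 : 0 < e0 by rewrite invr_gt0 mulr_gt0.
exists e0 => // T eta q0 p0 T0 eta0 q0n0.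
(* Gronwall over time [T] with rate [2 (A + eta' M)] must give [exp (eta M)] up to a constant. *)
pose eta' := eta / (2 * T).
have eta'0 : 0 < eta' by rewrite divr_gt0// mulr_gt0.
have eta2 : 0 < 2 * eta' by rewrite mulr_gt0.
pose A := 2 * dl ^+ 2 + 4 * dl * C3 + th * (1 + 4 * dl + 2 * C3 + 2 * C2).
have A0 : 0 <= A by rewrite /A !addr_ge0 ?mulr_ge0 ?addr_ge0 ?mulr_ge0 ?sqr_ge0.
pose B := dl ^+ 2 / (2 * eta') + th * dl.
have B0 : 0 <= B.
  by apply: addr_ge0; [apply: divr_ge0; [exact: sqr_ge0|exact: ltW]|exact: mulr_ge0].
pose S := 4 * th ^+ 2 + B / (2 * eta').
(* [Y0] bounds [y 0], which is known only to lie within [dl] of [p0]; [Lam] then bounds [LS 0]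
   uniformly in eps and [M]. *)
pose Y0 := enorm p0 + dl.
pose Lam := Y0 ^+ 2 + `|U q0 + G q0 + C0| + th * Y0 + S.
have Y00 : 0 <= Y0 by rewrite addr_ge0 ?enorm_ge0.
have S0 : 0 <= S.
  by apply: addr_ge0; [rewrite mulr_ge0 ?sqr_ge0|apply: divr_ge0 => //; exact: ltW].
have Lam0 : 0 <= Lam.
  have := sqr_ge0 Y0; have := normr_ge0 (U q0 + G q0 + C0).
  by have := mulr_ge0 th0 Y00; move: S0; rewrite /Lam; clear; lra.
(* The first factor collects [|q| <= 2 C4 E] and [|p| <= E / 2 + 4 + dl], constants becoming
   multiples of [E] through [E >= 1/2]. *)
pose C := (2 * C4 + 9 + 2 * dl) * (2 * (Lam + 1)) * expR (2 * A * T).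
exists C.
  rewrite !mulr_gt0 ?expR_gt0//; last by rewrite ltr_wpDl.
  by rewrite ltr_wpDr ?mulr_ge0// ltr_wpDl ?mulr_ge0.
move=> eps M q p y f /andP[eps0 epse0] M1 cq cy qn0 q0E p0E dq dy ypdl fM.
have M0 : 0 <= M by exact: le_trans M1.
have eth : 16 * th ^+ 2 * eps <= 1.
  have := ler_wpM2l (mulr_ge0 (ler0n _ 16) (sqr_ge0 th)) epse0.
  move=> /le_trans; apply; rewrite /e0 ler_pdivrMr ?mulr_gt0// mul1r; clear; lra.
have e16 : 16 * 1 ^+ 2 * eps <= 1.
  have := ler_wpM2l (ler0n R 16) epse0; rewrite expr1n mulr1.
  move=> /le_trans; apply; rewrite /e0 ler_pdivrMr ?mulr_gt0// mul1r.
  by have := sqr_ge0 th; clear; lra.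
pose E t := kin eps (y t) + U (q t) + G (q t) + C0.
have EK t : kin eps (y t) + U (q t) / 2 <= E t.
  by have := HC0 _ (qn0 t); rewrite /E; clear; lra.
have E12 t : kin eps (y t) + 1 / 2 <= E t.
  by apply: le_trans (EK t); have := U1 (q t); clear; lra.
pose Rd t := dotm (y t) (q t) / enorm (q t).
have RdE t : th * `|Rd t| <= E t / 2 + 4 * th ^+ 2.
  rewrite (@le_trans _ _ (th * enorm (y t)))//.
    by rewrite ler_wpM2l// radial_le.
  rewrite (le_trans (enorm_le_kin (y t) eps0 th0 eth))// lerD2r.
  by have := E12 t; have := kin_ge0 eps (y t); clear; lra.
pose L t := E t - th * Rd t.
have LE t : E t <= 2 * L t + 8 * th ^+ 2.
  have := RdE t; have : th * Rd t <= th * `|Rd t| by rewrite ler_wpM2l// ler_norm.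
  by rewrite /L; clear; lra.
pose yd t := - relvel eps (p t) - (grad U (q t) + grad G (q t)) + f t.
pose dE t := dotm (relvel eps (y t)) (yd t) + dotm (grad U (q t)) (relvel eps (p t))
   + dotm (grad G (q t)) (relvel eps (p t)).
pose dRd t := (dotm (yd t) (q t) + dotm (y t) (relvel eps (p t))
  - dotm (y t) (q t) * dotm (q t) (relvel eps (p t)) / enorm (q t) ^+ 2) / enorm (q t).
pose LS t := L t + S.
have dLS (t : R) : 0 < t < T -> is_derive t 1 LS (dE t - th * dRd t).
  move=> tT; have dqt := dq t tT; have dyt := dy t tT.
  have d1 := is_derive_kin eps0 dyt.
  have d2 := is_derive_grad dqt (dU (q t)).
  have d3 := is_derive_grad dqt (dG _ (qn0 t)).
  have d4 := is_derive_radial (qn0 t) dyt dqt.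
  have : is_derive t 1 ((fun s => kin eps (y s)) + (fun s => U (q s)) + (fun s => G (q s))
     + cst C0 - th *: Rd + cst S) (dE t - th * dRd t).
    by apply: is_derive_eq; rewrite addr0 addr0.
  by [].
have LS_le t : 0 < t < T -> dE t - th * dRd t <= (2 * (A + eta' * M)) * LS t.
  move=> /andP[t0 tT]; have tT' : 0 <= t <= T by rewrite (ltW t0) (ltW tT).
  have zdl := ypdl t tT'; have fdl := fM t tT'.
  have vdl : enorm (relvel eps (p t) - relvel eps (y t)) <= 2 * dl.
    by rewrite (le_trans (relvel_lipschitz _ _ eps0))// ler_wpM2l.
  have x0 : 0 < enorm (q t) by rewrite enorm_gt0.
  have h1 := energy_rate_le (f t) (grad U (q t) + grad G (q t)) vdl.
  rewrite -/(yd t) dotmDl addrA -/(dE t) in h1.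
  have h2 := radial_rate_ge (f t) (grad U (q t)) (grad G (q t)) eps0 (qn0 t) zdl.
  rewrite -/(yd t) in h2.
  have h3 := Himp _ (qn0 t).
  have h4 := enormD (grad U (q t)) (grad G (q t)).
  have h5 := HC3 (q t).
  have h6 : enorm (relvel eps (p t)) <= enorm (relvel eps (y t)) + 2 * dl.
    rewrite -(subrK (relvel eps (y t)) (relvel eps (p t))) (le_trans (enormD _ _))//.
    by rewrite addrC lerD2l.
  have h7 := relvel_sqr_le (y t) eps0.
  have nvy := enorm_ge0 (relvel eps (y t)).
  have dRE : dRd t * enorm (q t) = dotm (yd t) (q t) + dotm (y t) (relvel eps (p t))
    - dotm (y t) (q t) * dotm (q t) (relvel eps (p t)) / enorm (q t) ^+ 2.
    by rewrite /dRd divfK// gt_eqF.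
  rewrite -dRE in h2.
  have dd : dl ^+ 2 / 4 <= dl0 ^+ 2.
    rewrite (@le_trans _ _ (dl ^+ 2))//.
      by rewrite ler_pdivrMr// ler_peMr ?sqr_ge0// ler1n.
    by rewrite lerXn2r// nnegrE ltW.
  have hG : enorm (grad G (q t)) <=
      C1 * (dRd t + enorm (relvel eps (p t)) + enorm (grad U (q t)) + enorm (f t) + C2).
    rewrite -(ler_pM2r x0) (le_trans h3)// -mulrA ler_wpM2l//.
    by move: h2 dd; clear; lra.
  have := lyapunov_rate_le (erefl th) eta'0 dl_ge0 C10 C20 C30 M0 nvy (kin_ge0 eps (y t)) (U1 (q t))
    (EK t) h1 h4 hG h5 h6 h7 fdl.
  move=> /le_trans; apply.
  exact: (@lyapunov_rate_close R A eta' M B _ _ (th ^+ 2)).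
have cLS : continuous LS.
  move=> t.
  have c1 : {for t, continuous (fun s => kin eps (y s))} by exact: continuous_kin.
  have c2 : {for t, continuous (fun s => U (q s))}.
    by apply: (@continuous_comp _ _ _ q U); [exact: cq|exact: differentiable_continuous].
  have c3 : {for t, continuous (fun s => G (q s))}.
    by apply: (@continuous_comp _ _ _ q G); [exact: cq|exact/differentiable_continuous/dG].
  have c4 : {for t, continuous Rd} by exact: continuous_radial.
  apply: cvgD; last exact: cvg_cst.
  apply: cvgB; last by apply: cvgM; [exact: cvg_cst|exact: c4].
  apply: cvgD; last exact: cvg_cst.
  by apply: cvgD; [apply: cvgD; [exact: c1|exact: c2]|exact: c3].
move=> t tT; have /andP[t0 tT'] := tT.
have T00 : 0 <= (0 : R) <= T by apply/andP; split => //; exact: ltW.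
have y0 : enorm (y 0) <= Y0.
  have := ypdl 0 T00; rewrite p0E => z0.
  rewrite -(subKr p0 (y 0)) (le_trans (enormB _ _))// lerD2l//.
have LS0 : LS 0 <= Lam.
  rewrite /LS /L /Lam lerD2r /E q0E.
  have a1 : kin eps (y 0) <= Y0 ^+ 2.
    by rewrite (le_trans (kin_le _ eps0))// lerXn2r ?nnegrE ?enorm_ge0.
  have a2 := ler_norm (U q0 + G q0 + C0).
  have a3 : - (th * Rd 0) <= th * Y0.
    rewrite -mulrN ler_wpM2l// (le_trans (ler_norm _))// normrN.
    by rewrite (le_trans (radial_le _ (qn0 0))).
  by move: a1 a2 a3; clear; lra.
have := gronwall cLS dLS LS_le tT => LSt.
have AM0 : 0 <= 2 * (A + eta' * M) by rewrite mulr_ge0// addr_ge0// mulr_ge0// ltW.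
have LSt' : LS t <= (Lam + 1) * (expR (2 * A * T) * expR (eta * M)).
  rewrite (le_trans LSt)// (@le_trans _ _ ((Lam + 1) * expR (2 * (A + eta' * M) * t)))//.
    by rewrite ler_wpM2r ?expR_ge0// (le_trans LS0)// lerDl.
  apply: ler_wpM2l; first by rewrite addr_ge0.
  rewrite -expRD ler_expR.
  have -> : 2 * A * T + eta * M = 2 * (A + eta' * M) * T.
    by rewrite /eta'; field; rewrite gt_eqF.
  by rewrite ler_wpM2l.
have Et : E t <= 2 * ((Lam + 1) * (expR (2 * A * T) * expR (eta * M))).
  have b1 := LE t.
  have b2 : L t + 4 * th ^+ 2 <= LS t.
    by rewrite /LS /S lerD2l lerDl divr_ge0// ltW.
  by move: b1 b2 LSt'; clear; lra.
have ny : enorm (y t) <= E t / 2 + 4.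
  have := @enorm_le_kin R d eps 1 (y t) eps0 ler01 e16.
  by rewrite mul1r expr1n; have := E12 t; have := kin_ge0 eps (y t); clear; lra.
have np : enorm (p t) <= enorm (y t) + dl.
  rewrite -(subrK (y t) (p t)) (le_trans (enormD _ _))// addrC lerD2l.
  exact: ypdl.
have nq : enorm (q t) <= C4 * (2 * E t).
  rewrite (le_trans (HC4 _))// ler_wpM2l//.
  by have := EK t; have := kin_ge0 eps (y t); clear; lra.
have E1t := E12 t; have K0 := kin_ge0 eps (y t).
have fin : enorm (q t) + enorm (p t) <= (2 * C4 + 9 + 2 * dl) * E t.
  have E2 : 1 / 2 <= E t by move: E1t K0; clear; lra.
  by have := ler_wpM2l dl_ge0 E2; move: E2 ny np nq; clear; lra.
rewrite (le_trans fin)//.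
have -> : C * expR (eta * M) = (2 * C4 + 9 + 2 * dl) *
    (2 * ((Lam + 1) * (expR (2 * A * T) * expR (eta * M)))) by rewrite /C; ring.
by apply: ler_wpM2l => //; rewrite !addr_ge0// mulr_ge0.
Qed.

End energy.

(** * Smoothing the noise *)

(** The average is over the window [[t, t + h]]; looking ahead is harmless in a pathwise argument.
    The mean value theorem for the primitive shows that the average is a value taken by [w] in the
    window. *)
Lemma moving_average (R : realType) (w : R -> R) (h : R) : continuous w -> 0 < h ->
  exists g : R -> R, forall t : R, 0 <= t ->
    is_derive t 1 g ((w (t + h) - w t) / h) /\
    exists2 u, 0 <= u <= h & g t = w (t + u).
Proof.
move=> cw h0.
pose I t := \int[lebesgue_measure]_(s in `[-1, t]) w s.
have dI (t : R) : -1 < t -> is_derive t 1 I (w t).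
  by apply: (@is_derive_integral R w I (-1) 0 cw) => {}t t0; rewrite add0r.
exists (fun t => h^-1 * (I (t + h) - I t)) => t t0; split.
  have d1 := dI t ltac:(lra).
  have d2 : is_derive t 1 (fun s => I (s + h)) (w (t + h)).
    have ds : is_derive t 1 (fun s : R => s + h) 1.
      have : is_derive t 1 ((id : R -> R) + cst h) 1.
        by apply: is_derive_eq; rewrite addr0.
      by [].
    have dth := dI (t + h) ltac:(lra).
    have := @is_derive1_comp R I (fun s => s + h) t _ _ dth ds.
    by rewrite mulr1.
  have : is_derive t 1 (h^-1 *: ((fun s => I (s + h)) - I)) ((w (t + h) - w t) / h).
    by apply: is_derive_eq; rewrite /GRing.scale/= mulrC.
  by [].
have dI' (s : R) : s \in `]t, (t + h)[ -> is_derive s 1 I (w s).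
  by rewrite in_itv/= => /andP[ts _]; apply: dI; lra.
have cI : {within `[t, (t + h)], continuous I}.
  apply: derivable_within_continuous => s; rewrite in_itv/= => /andP[ts _].
  by have [] := dI s ltac:(lra).
have th : t <= t + h by lra.
have [s] := MVT_segment th dI' cI.
rewrite in_itv/= => /andP[ts sth] ->; exists (s - t).
  by apply/andP; split; lra.
by rewrite subrKC (addrC t) addrK mulrC mulfK// gt_eqF.
Qed.

Section apriori.
Context {R : realType} {d : nat} (U G : 'rV[R]_d -> R).
Hypothesis (AU : AssumptionU U) (AG : AssumptionG1 G).

Lemma rowmap1 (v : 'rV[R]_d -> 'rV[R]_d) p : rowmap v p = v p.
Proof.
by apply/matrixP => i k; rewrite mxE (ord1 i) row_id.
Qed.

(* Replacing the noise by its moving average over a window of length 1/M costs an error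
   bounded by the oscillation, and the averaged noise has a derivative of order M. *)
Lemma apriori_bound : exists2 dl : R, 0 < dl & exists2 e0 : R, 0 < e0 &
  forall (T eta : R) (q0 p0 : 'rV[R]_d), 0 < T -> 0 < eta -> q0 != 0 ->
  exists2 C : R, 0 < C &
  forall (eps M : R) (w q p : R -> 'rV[R]_d), 0 <= eps <= e0 -> 1 <= M ->
  continuous w ->
  path_sol (@relvel R eps d) (force1 U G) (~` [set 0]) q0 p0 w q p ->
  (forall t u k, 0 <= t <= T -> 0 <= u <= M^-1 -> `|w (t + u) 0 k - w t 0 k| <= dl) ->
  forall t, 0 <= t <= T -> enorm (q t) + enorm (p t) <= C * expR (eta * M).
Proof.
have [dl dl0 [e0 e00 H]] := energy_bound AU AG.
(* The 2 bounds [sqrt 2]; [d + 1] pays for passing from coordinates to the Euclidean norm and is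
   positive even for [d = 0]. *)
pose dl' := dl / (2 * d.+1%:R).
have d0 : 0 < 2 * d.+1%:R :> R by rewrite mulr_gt0.
have dl'0 : 0 < dl' by rewrite divr_gt0.
have s2 : Num.sqrt 2 <= 2 :> R.
  by rewrite -(@ler_pXn2r _ 2) ?nnegrE ?sqrtr_ge0// sqr_sqrtr//; lra.
have dldl' : Num.sqrt 2 * ((1 * d)%:R * dl') <= dl.
  rewrite (@le_trans _ _ (2 * (d.+1%:R * dl')))//.
    apply: ler_pM => //; first by rewrite mulr_ge0// ltW.
    by apply: ler_wpM2r; [exact: ltW|rewrite ler_nat mul1n].
  by rewrite mulrA /dl' mulrC divfK// gt_eqF.
exists dl' => //; exists e0 => // T eta q0 p0 T0 eta0 q0n0.
have [C C0 HC] := H T eta q0 p0 T0 eta0 q0n0.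
exists C => // eps M w q p eps0 M1 cw [Dq cq cp [q0E p0E] dqp] osc.
have M0 : 0 < M by exact: lt_le_trans M1.
have h0 : 0 < M^-1 by rewrite invr_gt0.
have cwk k : continuous (fun s => w s 0 k).
  by move=> s; have /continuous_mxP := cw s; apply.
have /choice[g Hg] k := moving_average (cwk k) h0.
pose gm t : 'rV[R]_d := \row_k g k t.
pose f t : 'rV[R]_d := (Num.sqrt 2 * M) *: (w (t + M^-1) - w t).
(* The noise in [p] is exchanged for its average, so [p - y] is [sqrt 2] times the noise minus its
   average. The clamp in [y] is there because the average is controlled for [t >= 0] only. *)
pose y0 t := p t - Num.sqrt 2 *: w t + Num.sqrt 2 *: gm t.
pose y t := y0 (Num.max 0 t).
have mE (t : R) : 0 <= t -> Num.max 0 t = t by move=> t0; apply/max_idPr.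
have cgm (t : R) : 0 <= t -> {for t, continuous gm}.
  move=> t0; apply/continuous_mxP => i k.
  rewrite (_ : (fun s => gm s i k) = g k); last by apply/funext => s; rewrite mxE.
  have [dg _] := (Hg k t t0).1.
  by apply: differentiable_continuous; apply/derivable1_diffP.
have cy : continuous y.
  move=> t.
  have m0 : 0 <= Num.max 0 t by rewrite le_max lexx.
  have cm : {for t, continuous (fun t : R => Num.max 0 t)}.
    by apply: continuous_max; [exact: cvg_cst|exact: cvg_id].
  apply: (@continuous_comp _ _ _ (fun t : R => Num.max 0 t) y0); first exact: cm.
  apply: cvgD; last by apply: cvgZr; exact: cgm.
  by apply: cvgB; [exact: cp|apply: cvgZr; exact: cw].
apply: (HC eps M q p y f) => //.
- by move=> t; apply/eqP; exact: Dq.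
- by move=> t /andP[t0 _]; have [+ _] := dqp t t0; rewrite rowmap1.
- move=> t /andP[t0 _]; have [_ dp] := dqp t t0.
  rewrite rowmap1 in dp.
  have dgm : is_derive t 1 gm (M *: (w (t + M^-1) - w t)).
    apply/is_derive_mxP => i k.
    rewrite (_ : (fun s => gm s i k) = g k); last by apply/funext => s; rewrite mxE.
    have := (Hg k t (ltW t0)).1; rewrite (ord1 i) invrK !mxE mulrC.
    by [].
  have : is_derive t 1 ((p - (fun s => Num.sqrt 2 *: w s)) + Num.sqrt 2 *: gm)
     (- relvel eps (p t) - (grad U (q t) + grad G (q t)) + f t).
    have dz := @is_deriveZ _ _ _ gm (Num.sqrt 2) t 1 _ dgm.
    by apply: (is_derive_eq (is_deriveD dp dz)); rewrite scalerA.
  apply: near_eq_is_derive; near=> s; rewrite /y mE//.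
  by rewrite ltW//; near: s; exact: lt_nbhsr.
- move=> t tT; have /andP[t0 _] := tT.
  rewrite /y mE// /y0.
  have -> : p t - (p t - Num.sqrt 2 *: w t + Num.sqrt 2 *: gm t) =
      Num.sqrt 2 *: (w t - gm t).
    by apply/matrixP => i k; rewrite !mxE; ring.
  rewrite enormZ ger0_norm ?sqrtr_ge0// (le_trans _ dldl')// ler_wpM2l ?sqrtr_ge0//.
  apply: enorm_le_coord => i k; rewrite !mxE (ord1 i).
  by have [_ [u uh ->]] := Hg k t t0; rewrite distrC; exact: osc.
- move=> t tT; rewrite /f enormZ ger0_norm ?mulr_ge0 ?sqrtr_ge0 ?(ltW M0)//.
  rewrite mulrAC ler_wpM2r ?(ltW M0)// (le_trans _ dldl')// ler_wpM2l ?sqrtr_ge0//.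
  apply: enorm_le_coord => i k; rewrite !mxE (ord1 i); apply: osc => //.
  by rewrite lexx (ltW h0).
Unshelve. all: by end_near. Qed.

End apriori.

(** * Oscillation of Brownian paths *)

Section chaining.
Context {R : realType} (f : R -> R) (c : R) (H J : nat).
Hypotheses (cf : continuous f) (c0 : 0 <= c).

Definition dyadic (i k : nat) : R := k%:R / 2 ^+ i.

Hypothesis inc : forall i k, (k < H * 2 ^ (J + i))%N ->
  `|f (dyadic (J + i) k.+1) - f (dyadic (J + i) k)| <= c * (3 / 4) ^+ i.

Let fl (t : R) i := Num.truncn (t * 2 ^+ (J + i)).

Let fl_itv t i : 0 <= t -> (fl t i)%:R <= t * 2 ^+ (J + i) < (fl t i).+1%:R.
Proof. by move=> t0; apply: truncn_itv; rewrite mulr_ge0// exprn_ge0. Qed.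

Let fl_lt t i : 0 <= t < H%:R -> (fl t i < H * 2 ^ (J + i))%N.
Proof.
move=> /andP[t0 tH]; rewrite truncn_lt_nat ?mulr_ge0 ?exprn_ge0//.
by rewrite natrM natrX ltr_pM2r// exprn_gt0.
Qed.

Let fl_step t i : 0 <= t -> fl t i.+1 = (fl t i).*2 \/ fl t i.+1 = (fl t i).*2.+1.
Proof.
move=> t0; have /andP[a1 a2] := fl_itv i t0; have /andP[b1 b2] := fl_itv i.+1 t0.
have e : t * 2 ^+ (J + i.+1) = 2 * (t * 2 ^+ (J + i)) by rewrite addnS exprS; ring.
rewrite e in b1 b2.
have h1 : ((fl t i).*2 < (fl t i.+1).+1)%N.
  rewrite -(ltr_nat R) -muln2 natrM mulrC (le_lt_trans _ b2)//.
  by rewrite ler_wpM2l.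
have h2 : (fl t i.+1 < (fl t i).+1.*2)%N.
  rewrite -(ltr_nat R) -muln2 natrM mulrC (le_lt_trans b1)//.
  by rewrite ltr_pM2l.
rewrite doubleS in h2.
have : (fl t i.+1 == (fl t i).*2) || (fl t i.+1 == (fl t i).*2.+1).
  by move: h1 h2; rewrite !ltnS => h1; rewrite leq_eqVlt ltnS => /orP[->|h2];
    rewrite ?orbT// eqn_leq h1 h2.
by move=> /orP[/eqP|/eqP]; [left|right].
Qed.

Let dyadic_double i k : dyadic i.+1 k.*2 = dyadic i k.
Proof.
rewrite /dyadic -muln2 natrM exprS; field.
by rewrite expf_neq0.
Qed.

(** Refining the grid by one level moves the grid point just left of [t] by zero or one step of the
    new level, so the increments sum to [c] times the geometric sum of [(3/4)^j], [1 <= j <= i]. *)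
Let chain t i : 0 <= t < H%:R ->
  `|f (dyadic (J + i) (fl t i)) - f (dyadic J (fl t 0))| <=
  3 * c * (1 - (3 / 4) ^+ i).
Proof.
move=> tH; have /andP[t0 _] := tH.
elim: i => [|i IH]; first by rewrite addn0 subrr normr0 expr0 subrr mulr0.
have r0 : 0 <= (3 / 4 : R) ^+ i by rewrite exprn_ge0// divr_ge0.
have step : `|f (dyadic (J + i.+1) (fl t i.+1)) - f (dyadic (J + i) (fl t i))| <=
    c * (3 / 4) ^+ i.+1.
  rewrite -(dyadic_double (J + i)) -addnS.
  have [->|->] := fl_step i t0.
    by rewrite subrr normr0 mulr_ge0// exprn_ge0// divr_ge0.
  apply: inc; rewrite addnS expnS mulnCA -muln2 mulnC ltn_pmul2l//.
  exact: fl_lt.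
rewrite -(subrKA (f (dyadic (J + i) (fl t i)))) (le_trans (ler_normD _ _))//.
rewrite (le_trans (lerD step IH))// exprS.
have := mulr_ge0 c0 r0; lra.
Qed.

Let chain_lim t : 0 <= t < H%:R -> `|f t - f (dyadic J (fl t 0))| <= 3 * c.
Proof.
move=> tH; have /andP[t0 _] := tH.
apply/ler_addgt0Pr => e e0.
have : f x @[x --> t] --> f t by exact: cf.
move=> /cvgrPdist_le/(_ e e0)/nbhs_ballP[r /= r0 rf].
have [i ir] : exists i, (2 ^+ i : R)^-1 < r.
  have [i ri] : exists i : nat, r^-1 < i%:R.
    by exists (Num.truncn r^-1).+1; rewrite -truncn_lt_nat// invr_ge0 ltW.
  exists i; rewrite invf_plt ?posrE ?exprn_gt0// (lt_trans ri)//.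
  by rewrite -natrX ltr_nat ltn_expl.
have p0 : 0 < (2 ^+ (J + i) : R) by rewrite exprn_gt0.
have near_t : `|f t - f (dyadic (J + i) (fl t i))| <= e.
  apply: rf; rewrite -ball_normE/=.
  have /andP[a1 a2] := fl_itv i t0.
  have -> : t - dyadic (J + i) (fl t i) =
      (t * 2 ^+ (J + i) - (fl t i)%:R) / 2 ^+ (J + i).
    by rewrite /dyadic mulrBl mulfK// gt_eqF.
  rewrite ger0_norm ?divr_ge0 ?subr_ge0 ?(ltW p0)// (le_lt_trans _ ir)//.
  rewrite ler_pdivrMr//.
  rewrite (@le_trans _ _ 1)//; first by move: a2; rewrite -natr1; lra.
  by rewrite ler_pdivlMl ?exprn_gt0// mulr1 ler_eXn2l ?ltr1n// leq_addl.
rewrite -(subrKA (f (dyadic (J + i) (fl t i)))) (le_trans (ler_normD _ _))//.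
rewrite addrC lerD// (le_trans (chain i tH))// ler_piMr ?mulr_ge0//.
Qed.

(** [7 = 3 + 3 + 1]: at each endpoint [f] is within [3 c] of its value at the grid point of level
    [J], and the two grid points are equal or adjacent since [u <= 2^-J]. *)
Lemma dyadic_chaining t u : 0 <= t -> 0 <= u <= (2 ^+ J)^-1 -> t + u < H%:R ->
  `|f (t + u) - f t| <= 7 * c.
Proof.
move=> t0 /andP[u0 uJ] tuH.
have tH : 0 <= t < H%:R by rewrite t0 (le_lt_trans _ tuH)// lerDl.
have tuH' : 0 <= t + u < H%:R by rewrite tuH addr_ge0.
have h1 := chain_lim tH; have h2 := chain_lim tuH'.
suff : `|f (dyadic J (fl (t + u) 0)) - f (dyadic J (fl t 0))| <= c.
  move: h1 h2; rewrite !ler_norml => /andP[? ?] /andP[? ?] /andP[? ?].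
  by apply/andP; split; lra.
have p0 : 0 < (2 ^+ J : R) by rewrite exprn_gt0.
have /andP[a1 a2] := fl_itv 0 t0.
have /andP[b1 b2] := fl_itv 0 (addr_ge0 t0 u0).
rewrite addn0 in a1 a2 b1 b2.
have u1 : u * 2 ^+ J <= 1 by rewrite -ler_pdivlMr// mul1r.
have u2 : 0 <= u * 2 ^+ J by rewrite mulr_ge0// ltW.
have e1 : (fl t 0 <= fl (t + u) 0)%N.
  rewrite -ltnS -(ltr_nat R) (le_lt_trans a1)// (le_lt_trans _ b2)//.
  by rewrite mulrDl lerDl.
have e2 : (fl (t + u) 0 <= (fl t 0).+1)%N.
  rewrite -ltnS -(ltr_nat R) (le_lt_trans b1)// mulrDl.
  by rewrite -[X in _ < X]natr1 ltr_leD.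
have : (fl (t + u) 0 == fl t 0) || (fl (t + u) 0 == (fl t 0).+1).
  by move: e2; rewrite leq_eqVlt => /orP[->|]; rewrite ?orbT// ltnS => e2; rewrite eqn_leq e1 e2.
move=> /orP[/eqP->|/eqP->]; first by rewrite subrr normr0.
by have := @inc 0 (fl t 0) (fl_lt 0 tH); rewrite addn0 expr0 mulr1.
Qed.

End chaining.

(** * Gaussian tails and summable weights *)

(** Half of the Gaussian exponent gives the tail factor, as [y^2 >= x^2]; the other half is, up to
    the factor [sqrt 2], the density of deviation [sqrt 2 * s], of total mass 1. *)
Lemma normal_tail (R : realType) (s x : R) : 0 < s -> 0 <= x ->
  (normal_prob 0 s [set y | (x < `|y|)%R] <=
   (Num.sqrt 2 * expR (- (x ^+ 2 / (4 * s ^+ 2))))%:E)%E.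
Proof.
move=> s0 x0; set K := Num.sqrt 2 * _.
have K0 : 0 <= K by rewrite mulr_ge0 ?sqrtr_ge0 ?expR_ge0.
have q2 : 0 < Num.sqrt 2 :> R by rewrite sqrtr_gt0.
have mV : measurable [set y : R | x < `|y|].
  rewrite (_ : [set _ | _] = setT `&` (fun y : R => `|y|) @^-1` `]x, +oo[%classic).
    have mn : measurable_fun setT (fun y : R => `|y|) by exact: normr_measurable.
    by apply: mn => //; exact: measurable_itv.
  by apply/seteqP; split => y /=; rewrite in_itv/= andbT => // -[].
have pdf_le (y : R) : x < `|y| ->
    normal_pdf 0 s y <= K * normal_pdf 0 (Num.sqrt 2 * s) y.
  move=> xy; rewrite !normal_pdfE ?gt_eqF ?mulr_gt0//.
  have -> : normal_peak s = Num.sqrt 2 * normal_peak (Num.sqrt 2 * s).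
    have e : Num.sqrt ((Num.sqrt 2 * s) ^+ 2 * pi *+ 2) =
        Num.sqrt 2 * Num.sqrt (s ^+ 2 * pi *+ 2).
      by rewrite -sqrtrM// exprMn sqr_sqrtr//; congr Num.sqrt; ring.
    by rewrite /normal_peak e invfM mulrA divff ?mul1r// gt_eqF.
  rewrite /K -[leLHS]mulrA -[leRHS]mulrA ler_wpM2l ?(ltW q2)// mulrCA ler_wpM2l ?normal_peak_ge0//.
  rewrite /normal_fun -expRD ler_expR !subr0 exprMn sqr_sqrtr//.
  have -> : - y ^+ 2 / (s ^+ 2 *+ 2) = - (y ^+ 2 / (4 * s ^+ 2)) + - y ^+ 2 / ((2 * s ^+ 2) *+ 2).
    by field; rewrite gt_eqF.
  have xy2 : x ^+ 2 <= y ^+ 2.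
    by rewrite -(real_normK (num_real y)) lerXn2r ?nnegrE// ltW.
  rewrite lerD2r lerN2; apply: ler_wpM2r => //.
  by rewrite invr_ge0 mulr_ge0 ?sqr_ge0.
rewrite /normal_prob.
have m1 (r : R) : measurable_fun setT (fun y => (normal_pdf 0 r y)%:E).
  by apply/measurable_EFinP; exact: measurable_normal_pdf.
have m2 : measurable_fun setT (fun y => (K * normal_pdf 0 (Num.sqrt 2 * s) y)%:E).
  by apply/measurable_EFinP; apply: measurable_funM => //; exact: measurable_normal_pdf.
apply: (@le_trans _ _ (\int[lebesgue_measure]_(y in [set y : R | (x < `|y|)%R])
   (K * normal_pdf 0 (Num.sqrt 2 * s) y)%:E)%E).
  apply: ge0_le_integral => //.
  - by move=> y _; rewrite lee_fin normal_pdf_ge0.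
  - exact: (measurable_funTS (m1 s)).
  - exact: (measurable_funTS m2).
apply: (@le_trans _ _ (\int[lebesgue_measure]_y
   (K * normal_pdf 0 (Num.sqrt 2 * s) y)%:E)%E).
  apply: ge0_subset_integral => //.
  by move=> y _; rewrite lee_fin mulr_ge0 ?normal_pdf_ge0.
under eq_integral do rewrite EFinM.
rewrite ge0_integralZl//.
  by rewrite integral_normal_pdf mule1.
- exact: m1.
- by move=> y _; rewrite lee_fin normal_pdf_ge0.
Qed.

Section series.
Context {R : realType}.
Local Open Scope ereal_scope.

Lemma nneseries_half_le (u : nat -> \bar R) (c : R) : (0 <= c)%R ->
  (forall k, 0 <= u k <= (c / 2 ^+ k)%:E) -> \sum_(k <oo) u k <= (2 * c)%:E.
Proof.
move=> c0 uc.
apply: (@le_trans _ _ (\sum_(k <oo) (c / 2 ^+ k)%:E)).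
  by apply: lee_nneseries => k *; have /andP[] := uc k.
have := @cvg_geometric_series R c 2^-1.
rewrite ger0_norm// => /(_ _)/wrap[|cvg].
  by rewrite invf_lt1// ltr1n.
have -> : \sum_(k <oo) (c / 2 ^+ k)%:E = limn (EFin \o series (geometric c 2^-1)).
  congr (limn _); apply/funext => n /=; rewrite sumEFin.
  by congr EFin; apply: eq_bigr => k _; rewrite /geometric/= exprVn.
rewrite (_ : (2 * c)%R = c / (1 - 2^-1))%R; last by field.
apply: lime_le; first by apply: cvgP; apply: cvg_EFin; [exact: nearW|exact: cvg].
apply: nearW => n; rewrite lee_fin; apply: geometric_le_lim => //.
by rewrite ger0_norm// invf_lt1// ltr1n.
Qed.

End series.

Lemma expRN_le_powV (R : realType) (m : nat) : exists2 F : R, 0 <= F &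
  forall z, 0 < z -> expR (- z) <= F / z ^+ m.+1.
Proof.
exists m.+1`!%:R => // z z0.
rewrite expRN -[leRHS]invrK lef_pV2 ?posrE ?expR_gt0 ?invr_gt0 ?divr_gt0 ?exprn_gt0//.
  by rewrite invf_div (le_trans _ (expR_ge1Dxn m (ltW z0)))// lerDr.
Qed.

(** Twelve is the least exponent for which a power of [9 / 8] reaches 4. From one level to the next,
    one factor 2 is needed for the number of intervals and another for summability. *)
Lemma pow_9_8_ge (R : realType) : 2 ^+ 2 <= (9 / 8 : R) ^+ 12.
Proof.
have q : 8 / 5 <= (9 / 8 : R) ^+ 4 by rewrite !exprS expr0; lra.
have e0 : 0 <= (8 / 5 : R) by lra.
have q3 : (8 / 5 : R) ^+ 3 <= ((9 / 8) ^+ 4) ^+ 3.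
  by rewrite lerXn2r// nnegrE (le_trans e0).
by rewrite (exprM _ 4 3) (le_trans _ q3)// !exprS expr0; lra.
Qed.

(** The number of intervals per unit time is multiplied by a weight and by a Gaussian tail. Half of
    the tail exponent cancels the weight; the other half, bounded by an inverse twelfth power, beats
    the number of intervals and leaves decay in both indices. *)
Lemma dyadic_tail_le (R : realType) (k : R) : 0 < k ->
  exists2 K, 0 <= K & forall J i : nat,
    2 ^+ (J + i) * (expR (k * 2 ^+ J) * expR (- (2 * k * 2 ^+ J * (9 / 8) ^+ i))) <=
    K / 2 ^+ J / 2 ^+ i.
Proof.
move=> k0; have [F F0 HF] := expRN_le_powV R 11.
exists (F / k ^+ 12); first by rewrite divr_ge0// exprn_ge0// ltW.
move=> J i.
set a := 2 ^+ J; set b := 2 ^+ i; set r := (9 / 8) ^+ i.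
have a0 : 0 < a by rewrite exprn_gt0.
have b0 : 0 < b by rewrite exprn_gt0.
have r0 : 0 < r by rewrite exprn_gt0// divr_gt0.
have r1 : 1 <= r by rewrite exprn_ege1//; lra.
pose z := k * a * r.
have ka : 0 < k * a by rewrite mulr_gt0.
have z0 : 0 < z by rewrite mulr_gt0.
rewrite -expRD exprD -/a -/b.
have h1 : expR (k * a + - (2 * k * a * r)) <= expR (- z).
  have : k * a <= z by rewrite /z ler_peMr// ltW.
  by rewrite ler_expR /z; lra.
have h2 := le_trans h1 (HF _ z0).
have p0 : 0 < a * b by rewrite mulr_gt0.
apply: (@le_trans _ _ (a * b * (F / z ^+ 12))).
  by apply: ler_wpM2l => //; exact: ltW.
have h3 : k ^+ 12 * (a * b) ^+ 2 <= z ^+ 12.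
  have -> : z ^+ 12 = k ^+ 12 * (a ^+ 12 * r ^+ 12) by rewrite /z; ring.
  apply: ler_wpM2l; first by rewrite exprn_ge0// ltW.
  rewrite exprMn; apply: ler_pM; rewrite ?exprn_ge0 ?(ltW a0) ?(ltW b0)//.
    by rewrite ler_weXn2l// exprn_ege1// ler1n.
  rewrite /b /r -!exprM mulnC [(i * 12)%N]mulnC !exprM lerXn2r ?nnegrE ?exprn_ge0//.
  exact: pow_9_8_ge.
have kk : 0 < k ^+ 12 by rewrite exprn_gt0.
have -> : F / k ^+ 12 / a / b = a * b * (F / (k ^+ 12 * (a * b) ^+ 2)).
  by field; rewrite !gt_eqF.
apply: ler_wpM2l; first exact: ltW.
apply: ler_wpM2l => //; rewrite lef_pV2// posrE ?exprn_gt0//.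
by rewrite mulr_gt0// exprn_gt0.
Qed.

Lemma measure_bigsetU_le (R : realType) (dO : measure_display)
    (Omega : measurableType dO) (P : {measure set Omega -> \bar R})
    (I : finType) (A : I -> set Omega) (c : R) :
  (forall i, measurable (A i)) -> (forall i, (P (A i) <= c%:E)%E) ->
  (P (\big[setU/set0]_i A i) <= (#|I|%:R * c)%:E)%E.
Proof.
move=> mA PA.
apply: (@le_trans _ _ (\sum_i P (A i))%E); last first.
  apply: (@le_trans _ _ (\sum_(i : I) c%:E)%E); first by apply: lee_sum => i _; exact: PA.
  by rewrite sumEFin sumr_const mulr_natl.
pose K (X : set Omega) (x : \bar R) := measurable X /\ (P X <= x)%E.
suff : K (\big[setU/set0]_i A i) (\sum_i P (A i))%E by case.
apply: (big_ind2 K) => [|X x Y y [mX Xx] [mY Yy]|i _]; rewrite /K.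
- by split; [exact: measurable0|rewrite measure0].
- split; first exact: measurableU.
  by apply: le_trans (measureU2 P mX mY) _; exact: leeD.
- by split => //; exact: mA.
Qed.

Section brownian.
Context {R : realType} {dO : measure_display} {Omega : measurableType dO}.
Variables (P : probability Omega R) (n d : nat) (W : R -> Omega -> 'M[R]_(n, d)).
Hypothesis BW : std_brownian P W.

Lemma brownian_increment_tail (a b x : R) i k : 0 <= a -> a < b -> 0 <= x ->
  let A := [set w | x < `|W b w i k - W a w i k|] in
  measurable A /\ (P A <= (Num.sqrt 2 * expR (- (x ^+ 2 / (4 * (b - a)))))%:E)%E.
Proof.
move=> a0 ab x0 A.
have [_ _ H] := BW.
pose ts (j : nat) : R := if j is 0%N then a else b.
have tsP j : (j < 1)%N -> ts j < ts j.+1 by case: j.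
have [[mI _] law] := H 1%N ts a0 tsP.
pose y : 'I_1 * 'I_n * 'I_d := (ord0, i, k).
have mB : measurable [set z : R | x < `|z|].
  rewrite (_ : [set _ | _] = setT `&` (fun y : R => `|y|) @^-1` `]x, +oo[%classic).
    have mn : measurable_fun setT (fun y : R => `|y|) by exact: normr_measurable.
    by apply: mn => //; exact: measurable_itv.
  by apply/seteqP; split => z /=; rewrite in_itv/= andbT => // -[].
have AE : A = (fun w => W b w i k - W a w i k) @^-1` [set z : R | x < `|z|] by [].
split.
  by rewrite AE -[X in measurable X]setTI; exact: (mI y).
have sab : 0 < Num.sqrt (b - a) by rewrite sqrtr_gt0 subr_gt0.
rewrite AE (law y _ mB)/= (le_trans (normal_tail sab x0))//.
by rewrite sqr_sqrtr ?subr_ge0// ltW.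
Qed.

Variables (c : R) (H : nat).
Hypothesis c0 : 0 < c.

(** Per level the threshold shrinks by 3/4 and the deviation of the increments by [2^(-1/2)], which
    is faster: the tail exponent grows like [(9/8)^i] while the thresholds stay summable. *)
Let bad1 (J i : nat) (x : 'I_(H * 2 ^ (J + i)) * ('I_n * 'I_d)) : set Omega :=
  [set w | c * (3 / 4) ^+ i < `|W (dyadic (J + i) x.1.+1) w x.2.1 x.2.2 -
                                W (dyadic (J + i) x.1) w x.2.1 x.2.2|].

Let bad J := \bigcup_i \big[setU/set0]_x (@bad1 J i x).

(** Chosen so that the tail exponent at level [J + i] is [2 k 2^J (9/8)^i], leaving half of it for
    the weight [exp (k 2^J)]. *)
Let k := c ^+ 2 / 8.

Let k0 : 0 < k. Proof. by rewrite divr_gt0// exprn_gt0. Qed.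

Let bad1P J i x : measurable (@bad1 J i x) /\
  (P (@bad1 J i x) <= (Num.sqrt 2 * expR (- (2 * k * 2 ^+ J * (9 / 8) ^+ i)))%:E)%E.
Proof.
have p0 : 0 < (2 : R) ^+ (J + i) by rewrite exprn_gt0.
have := @brownian_increment_tail (dyadic (J + i) x.1) (dyadic (J + i) x.1.+1)
  (c * (3 / 4) ^+ i) x.2.1 x.2.2.
have e : dyadic (J + i) x.1.+1 - dyadic (J + i) x.1 = (2 ^+ (J + i))^-1 :> R.
  by rewrite /dyadic -mulrBl -natr1 addrAC subrr add0r mul1r.
case.
- by rewrite divr_ge0// ltW.
- by rewrite -subr_gt0 e invr_gt0.
- by rewrite mulr_ge0 ?(ltW c0)// exprn_ge0// divr_ge0.
move=> mA; rewrite e => /le_trans PA; split => //; apply: PA.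
rewrite lee_fin ler_wpM2l ?sqrtr_ge0// ler_expR lerN2.
rewrite le_eqVlt; apply/orP; left; apply/eqP.
have -> : (9 / 8 : R) ^+ i = ((3 / 4) ^+ i) ^+ 2 * 2 ^+ i.
  by rewrite -exprM mulnC exprM -exprMn; congr (_ ^+ i); field.
by rewrite /k exprD; field; rewrite !expf_neq0.
Qed.

Let mbad J : measurable (bad J).
Proof.
apply: bigcup_measurable => i _; apply: bigsetU_measurable => x _.
by case: (bad1P x).
Qed.

Let Pbad : exists2 K : R, 0 <= K & forall J,
  ((expR (k * 2 ^+ J))%:E * P (bad J) <= (K / 2 ^+ J)%:E)%E.
Proof.
have [K K0 HK] := dyadic_tail_le k0.
pose D : R := (H * (n * d))%:R * Num.sqrt 2.
have D0 : 0 <= D by rewrite mulr_ge0 ?sqrtr_ge0.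
exists (2 * (D * K)); first by rewrite !mulr_ge0.
move=> J.
have : (P (bad J) <= \sum_(i <oo) P (\big[setU/set0]_x (@bad1 J i x)))%E.
  apply: measure_sigma_subadditive; [|exact: mbad|by []].
  by move=> i; apply: bigsetU_measurable => x _; case: (bad1P x).
have e0 : (0 <= (expR (k * 2 ^+ J))%:E)%E by rewrite lee_fin expR_ge0.
move=> /(lee_wpmul2l e0)/le_trans; apply.
rewrite -nneseriesZl//.
have -> : 2 * (D * K) / 2 ^+ J = 2 * (D * K / 2 ^+ J) by ring.
apply: nneseries_half_le; first by rewrite divr_ge0 ?mulr_ge0// exprn_ge0.
move=> i; apply/andP; split; first by rewrite mule_ge0.
have := @measure_bigsetU_le R _ _ P _ (@bad1 J i) _ (fun x => (bad1P x).1) (fun x => (bad1P x).2).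
move=> /(lee_wpmul2l e0)/le_trans; apply.
rewrite -EFinM lee_fin !card_prod !card_ord natrM natrM natrX.
have := ler_wpM2l D0 (HK J i).
rewrite /D natrM mulrA.
set E1 := expR _; set E2 := expR _ => h.
have -> : E1 * (H%:R * 2 ^+ (J + i) * (n * d)%:R * (Num.sqrt 2 * E2)) =
   H%:R * (n * d)%:R * Num.sqrt 2 * (2 ^+ (J + i)) * (E1 * E2) by ring.
by rewrite (le_trans _ (le_trans h _))// !mulrA.
Qed.

Let clampW w i l : continuous (fun t : R => W (Num.max 0 t) w i l).
Proof.
have [_ cW _] := BW; have := continuous_clamp (cW w) => cWw t.
have : {for t, continuous (fun t : R => W (Num.max 0 t) w)} by exact: cWw.
by move=> /continuous_mxP; apply.
Qed.

Let not_bad_osc J w : ~ bad J w -> forall t u i l, 0 <= t -> 0 <= u <= (2 ^+ J)^-1 ->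
  t + u < H%:R -> `|W (t + u) w i l - W t w i l| <= 7 * c.
Proof.
move=> nb t u i l t0 u0 tuH.
have mE (s : R) : 0 <= s -> Num.max 0 s = s by move=> s0; apply/max_idPr.
have d0 j m : 0 <= dyadic j m :> R by rewrite divr_ge0// exprn_ge0.
have := @dyadic_chaining R (fun t => W (Num.max 0 t) w i l) c H J (@clampW w i l) (ltW c0) _ t u t0 u0 tuH.
rewrite !mE//; last by rewrite addr_ge0//; case/andP: u0.
apply => j m mH; rewrite !mE// leNgt; apply/negP => mbig; apply: nb.
exists j => //; rewrite (bigD1 (Ordinal mH, (i, l)))//=.
by left.
Qed.

(* If no scale is good then every term of the series is at least 1, and Y = +oo. *)
Lemma brownian_osc_domination : exists2 eta : R, 0 < eta &
  exists Y : Omega -> \bar R, [/\ P.-integrable setT Y, forall w, (0 <= Y w)%E &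
  forall w, Y w = +oo%E \/ exists J : nat,
    (forall t u i l, 0 <= t -> 0 <= u <= (2 ^+ J)^-1 -> t + u < H%:R ->
      `|W (t + u) w i l - W t w i l| <= 7 * c) /\
    ((expR (eta * 2 ^+ J))%:E <= Y w)%E].
Proof.
(* If [J + 1] is the first good scale, [J] is bad and [exp (eta 2^(J+1)) = exp (k 2^J)] is the term
   of index [J] in the series. *)
pose eta := k / 2.
exists eta; first by rewrite divr_gt0.
have [K K0 HK] := Pbad.
pose g J w : \bar R := (expR (k * 2 ^+ J) * \1_(bad J) w)%:E.
have g0 J w : (0 <= g J w)%E by rewrite lee_fin mulr_ge0 ?expR_ge0.
have mg J : measurable_fun setT (g J).
  by apply/measurable_EFinP; apply: measurable_funM => //; exact: measurable_indic.
pose S w := (\sum_(J <oo) g J w)%E.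
have S0 w : (0 <= S w)%E by exact: nneseries_ge0.
have mS : measurable_fun setT S by exact: ge0_emeasurable_sum.
(* The constant [exp eta] covers the case where scale 0 is already good. *)
pose Y w := ((expR eta)%:E + S w)%E.
have Y0 w : (0 <= Y w)%E by rewrite adde_ge0// lee_fin expR_ge0.
have mY : measurable_fun setT Y by exact: emeasurable_funD.
exists Y; split => //.
  apply/integrableP; split => //.
  under eq_integral do rewrite gee0_abs//.
  rewrite ge0_integralD//.
  have -> : (\int[P]_w (expR eta)%:E = (expR eta)%:E)%E.
    rewrite integral_cst//; transitivity ((expR eta)%:E * 1)%E; last exact: mule1.
    by congr (_ * _)%E; exact: probability_setT.
  rewrite lte_add_pinfty ?ltry//.
  rewrite integral_nneseries//.
  apply: (@le_lt_trans _ _ (2 * K)%:E); last exact: ltry.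
  apply: nneseries_half_le => // J; rewrite integral_ge0//=.
  under eq_integral do rewrite /g EFinM.
  rewrite ge0_integralZl//.
  - by rewrite integral_indic// setIT; exact: HK.
  - by apply/measurable_EFinP; exact: measurable_indic.
move=> w.
have [[J0 goodJ0]|allbad] := pselect (exists J, ~ bad J w); last first.
  left; apply/eqP; rewrite eq_le leey/=.
  have SM (m : nat) : ((m%:R : R)%:E <= S w)%E.
    apply: (@le_trans _ _ (\sum_(0 <= J < m) g J w)%E); last first.
      by apply: nneseries_lim_ge => J *.
    have -> : (m%:R : R)%:E = (\sum_(0 <= J < m) (1 : R)%:E)%E.
      by rewrite sumEFin big_const_nat subn0 iter_addr addr0.
    apply: lee_sum => J _; rewrite lee_fin indicE mem_set; last first.
      by apply: contrapT => nb; apply: allbad; exists J.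
    by rewrite mulr1 -[leLHS]expR0 ler_expR mulr_ge0 ?exprn_ge0// ltW.
  rewrite /Y; suff -> : S w = +oo%E by rewrite addey.
  apply/eq_infty => r.
  apply: le_trans (SM (Num.truncn `|r|).+1); rewrite lee_fin.
  have := truncn_itv (normr_ge0 r) => /andP[_ /ltW]; apply: le_trans.
  exact: ler_norm.
right.
have exJ : exists J, `[< ~ bad J w >] by exists J0; apply/asboolP.
case: (ex_minnP exJ) => J /asboolP nb minJ; exists J; split.
  exact: not_bad_osc.
case: J nb minJ => [nb _|J nb minJ].
  by rewrite expr0 mulr1 leeDl.
have bJ : bad J w.
  apply: contrapT => nbJ.
  by have := minJ J (introT (asboolP _) nbJ); rewrite ltnn.
apply: (@le_trans _ _ (g J w)).
  rewrite lee_fin indicE mem_set// mulr1 ler_expR /eta exprS.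
  by rewrite mulrA divfK.
apply: (@le_trans _ _ (S w)); last by rewrite leeDr// lee_fin expR_ge0.
rewrite /S (@nneseriesD1 _ _ J)// leeDl//.
by apply: nneseries_ge0 => *.
Qed.

End brownian.

(** * Passage to the limit *)

(** If the limit failed, some neighbourhood of [l] would be missed at points arbitrarily close to 0,
    and a sequence of them contradicts the hypothesis. *)
Lemma cvg_at_right0_seq (R : realType) (T : topologicalType) (f : R -> T) (l : T) (e0 : R) :
  0 < e0 ->
  (forall u : nat -> R, (forall n, 0 < u n < e0) -> u @ \oo --> 0 ->
    f (u n) @[n --> \oo] --> l) ->
  f x @[x --> 0^'+] --> l.
Proof.
move=> e00 H A nA; apply: contrapT => nearA.
have h (n : nat) : exists x, 0 < x < Num.min e0 n.+1%:R^-1 /\ ~ A (f x).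
  apply: contrapT => /forallNP h; apply: nearA.
  have m0 : 0 < Num.min e0 n.+1%:R^-1 by rewrite lt_min e00 invr_gt0/=.
  rewrite /nbhs/=; near=> x; apply: contrapT => nAx; apply: (h x); split => //.
  by apply/andP; split; near: x; [exact: nbhs_right_gt|exact: nbhs_right_lt].
have [u uP] := choice h.
have u0 n : 0 < u n < e0.
  by have [/andP[-> +] _] := uP n; rewrite lt_min => /andP[->].
have cu : u @ \oo --> 0.
  apply/cvgrPdist_lt => e e_gt0; near=> n.
  have [/andP[un0 +] _] := uP n; rewrite lt_min => /andP[_ un].
  rewrite sub0r normrN gtr0_norm// (lt_trans un)//.
  by near: n; exact: (near_infty_natSinv_lt (PosNum e_gt0)).
have [N _ HN] := H u u0 cu A nA.
by have [_] := uP N; apply; exact: (HN N (leqnn N)).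
Unshelve. all: by end_near. Qed.

(** * Measurability of suprema over a time interval *)

Section sup_process.
Context {R : realType} {dO : measure_display} {Omega : measurableType dO}.

Definition supproc (T : R) (X : R -> Omega -> R) (w : Omega) : \bar R :=
  ereal_sup [set (X t w)%:E | t in `[0, T]].

(** By continuity the supremum may be taken over the rationals clamped to [[0, T]], a countable
    family. *)
Lemma measurable_supproc (T : R) (X : R -> Omega -> R) : 0 < T ->
  (forall t, measurable_fun setT (X t)) ->
  (forall w, continuous (fun t : R => X (Num.max 0 t) w)) ->
  measurable_fun setT (supproc T X).
Proof.
move=> T0 mX cX.
pose cl (s : R) := Num.max 0 (Num.min T s).
have cl_itv s : 0 <= cl s <= T.
  by rewrite /cl le_max lexx ge_max (ltW T0) ge_min lexx.
have cl_id t : 0 <= t <= T -> cl t = t.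
  by move=> /andP[t0 tT]; rewrite /cl (min_idPr tT) (max_idPr t0).
(* The default 0 serves the integers that code no rational; clamping keeps every entry in
   [[0, T]]. *)
pose r (n : nat) : R := cl (ratr (odflt 0 (unpickle n : option rat))).
have -> : supproc T X = (fun w => esups (fun n => (X (r n) w)%:E) 0%N).
  apply/funext => w; apply/eqP; rewrite eq_le; apply/andP; split; last first.
    apply: le_ereal_sup => _ [n _ <-]; exists (r n) => //=; rewrite in_itv/=.
    exact: cl_itv.
  apply: ub_ereal_sup => _ [t /= + <-]; rewrite in_itv/= => tT.
  apply/lee_addgt0Pr => e e0.
  have : {for t, continuous (fun s => X (cl s) w)}.
    apply: (@continuous_comp _ _ _ (fun s : R => Num.min T s) (fun s : R => X (Num.max 0 s) w)).
      by apply: continuous_min; [exact: cvg_cst|exact: cvg_id].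
    exact: cX.
  move=> /cvgrPdist_le/(_ e e0)/nbhs_ballP[rho /= rho0 hr].
  have [q] : exists q, ratr q \in `]t - rho, t + rho[ by apply: rat_in_itvoo; lra.
  rewrite in_itv/= => /andP[q1 q2].
  have := hr (ratr q); rewrite -ball_normE/= => /(_ _)/wrap[|].
    by rewrite ltr_norml; apply/andP; split; lra.
  rewrite cl_id// ler_norml => /andP[_ h].
  apply: (@le_trans _ _ ((X (cl (ratr q)) w)%:E + e%:E)%E).
    by rewrite -EFinD lee_fin; lra.
  rewrite leeD2r//; apply: ereal_sup_ubound; exists (pickle q) => //=.
  by rewrite /r pickleK.
by apply: measurable_fun_esups => n; apply/measurable_EFinP; exact: mX.
Qed.

Lemma supproc_le (T : R) X w (b : \bar R) :
  (forall t, 0 <= t <= T -> ((X t w)%:E <= b)%E) -> (supproc T X w <= b)%E.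
Proof.
move=> H; apply: ub_ereal_sup => _ [t /= + <-].
by rewrite in_itv/= => /H.
Qed.

Lemma supproc_ge0 (T : R) X w : 0 < T -> (forall t, 0 <= X t w) ->
  (0 <= supproc T X w)%E.
Proof.
move=> T0 X0; apply: (@le_trans _ _ (X 0 w)%:E); first by rewrite lee_fin.
by apply: ereal_sup_ubound; exists 0 => //=; rewrite in_itv/= lexx ltW.
Qed.

Lemma measurable_enorm n d (X : Omega -> 'M[R]_(n, d)) :
  (forall i k, measurable_fun setT (fun w => X w i k)) ->
  measurable_fun setT (fun w => enorm (X w)).
Proof.
move=> mX; rewrite /enorm.
apply: (@measurableT_comp _ _ _ _ _ _ (@Num.sqrt R)).
  by apply: continuous_measurable_fun; exact: sqrt_continuous.
apply: measurable_sum => i; apply: measurable_sum => k.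
by apply: measurable_funX; exact: mX.
Qed.

Lemma measurable_enormB n d (X Y : R -> Omega -> 'M[R]_(n, d)) t :
  good_process X -> good_process Y ->
  measurable_fun setT (fun w => enorm (X t w - Y t w)).
Proof.
move=> [mX _] [mY _]; apply: measurable_enorm => i k.
rewrite (_ : (fun _ => _) = (fun w => X t w i k - Y t w i k)).
  by apply: measurable_funB; [exact: mX|exact: mY].
by apply/funext => w; rewrite !mxE.
Qed.

Lemma continuous_enormB n d (X Y : R -> Omega -> 'M[R]_(n, d)) w :
  good_process X -> good_process Y ->
  continuous (fun t : R => enorm (X (Num.max 0 t) w - Y (Num.max 0 t) w)).
Proof.
move=> [_ /(_ w)/continuous_clamp cX] [_ /(_ w)/continuous_clamp cY] t.
have cXt : {for t, continuous (fun t : R => X (Num.max 0 t) w)} by exact: cX.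
have cYt : {for t, continuous (fun t : R => Y (Num.max 0 t) w)} by exact: cY.
exact: continuous_enorm (continuousB cXt cYt).
Qed.

End sup_process.

Section pathwise.
Context {R : realType} {dO : measure_display} {Omega : measurableType dO}.
Variables (P : probability Omega R) (n d : nat) (W : R -> Omega -> 'M[R]_(n, d)).
Variables (F : 'M[R]_(n, d) -> 'M[R]_(n, d)) (D : set 'M[R]_(n, d)).
Variables (q0 p0 : 'M[R]_(n, d)).
Variables (qe pe : R -> R -> Omega -> 'M[R]_(n, d)) (ql pl : R -> Omega -> 'M[R]_(n, d)).
Hypothesis W0 : forall w, W 0 w = 0.
Hypothesis lF : forall x, D x -> loclip F x.
Hypothesis rel_sol : forall eps : R, 0 < eps < 1 ->
  {ae P, forall w, is_solution (@relvel R eps d) F D q0 p0 (fun t => W t w)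
     (fun t => qe eps t w) (fun t => pe eps t w)}.
Hypothesis lang_sol : {ae P, forall w, is_solution (@langvel R d) F D q0 p0 (fun t => W t w)
     (fun t => ql t w) (fun t => pl t w)}.

Definition clamped_sols (u : nat -> R) (w : Omega) : Prop :=
  path_sol (@langvel R d) F D q0 p0 ((W^~ w) \o Num.max 0) ((ql^~ w) \o Num.max 0)
    ((pl^~ w) \o Num.max 0) /\
  forall m, path_sol (@relvel R (u m) d) F D q0 p0 ((W^~ w) \o Num.max 0)
    ((qe (u m))^~ w \o Num.max 0) ((pe (u m))^~ w \o Num.max 0).

Lemma ae_clamped_sols (u : nat -> R) : (forall m, 0 < u m < 1) ->
  {ae P, forall w, clamped_sols u w}.
Proof.
move=> u01.
have cF x : D x -> {for x, continuous F} by move=> /lF/loclip_continuous.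
have cl : continuous (@langvel R d) by rewrite -relvel0; exact: continuous_relvel.
have := ae_foralln (fun m => rel_sol (u01 m)).
apply: filterS2 lang_sol => w hl hr; split.
  exact: is_solution_clamp.
move=> m; apply: is_solution_clamp => //.
by apply: continuous_relvel; have /andP[/ltW] := u01 m.
Qed.

Lemma clamped_sols_cvg (u : nat -> R) w (T xi : R) : 0 < T -> 0 < xi ->
  (forall m, 0 < u m < 1) -> u @ \oo --> 0 -> clamped_sols u w ->
  \forall m \near \oo, forall t, 0 <= t <= T ->
    enorm (qe (u m) t w - ql t w) + enorm (pe (u m) t w - pl t w) < xi.
Proof.
move=> T0 xi0 u01 cu [hl hr].
have [e0 e00 He] := newtonian_limit_path lF T0 xi0 hl.
near=> m => t tT.
have /andP[t0 _] := tT.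
have um : 0 < u m < e0.
  have /andP[u0 _] := u01 m; rewrite u0/=.
  by near: m; apply: (cvgr_lt _ cu).
by have := He _ um _ _ (hr m) t tT; rewrite /= (max_idPr t0).
Unshelve. all: by end_near. Qed.

End pathwise.

Section limits.
Context {R : realType} {dO : measure_display} {Omega : measurableType dO}.
Variables (P : probability Omega R).

Lemma cvg_measure_ae_evanescent (A : nat -> set Omega) :
  (forall m, measurable (A m)) ->
  {ae P, forall w, \forall m \near \oo, ~ A m w} ->
  P (A m) @[m --> \oo] --> 0%E.
Proof.
move=> mA aeA.
have := @dominated_convergence _ _ _ P setT measurableT (fun m w => (\1_(A m) w)%:E)
  (cst 0%E) (cst 1%E).
case.
- by move=> m; apply/measurable_EFinP; exact: measurable_indic.
- exact: measurable_cst.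
- apply: filterS aeA => w Aw _; apply: cvg_near_cst.
  by apply: filterS Aw => m nA; rewrite indicE memNset.
- exact: (finite_measure_integrable_cst P 1).
- by apply: nearW => w m _; rewrite /= lee_fin ger0_norm// indicE lern1 leq_b1.
move=> _ _; rewrite integral0; apply: cvg_trans; apply: near_eq_cvg; apply: nearW => m /=.
by rewrite integral_indic// setIT.
Qed.

Lemma cvg_integral_dominated0 (f : nat -> Omega -> \bar R) (g : Omega -> \bar R) :
  (forall m, measurable_fun setT (f m)) -> (forall m w, (0 <= f m w)%E) ->
  P.-integrable setT g ->
  {ae P, forall w, forall m, (f m w <= g w)%E} ->
  {ae P, forall w, forall e : R, 0 < e -> \forall m \near \oo, (f m w <= e%:E)%E} ->
  (\int[P]_w f m w)%E @[m --> \oo] --> 0%E.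
Proof.
move=> mf f0 ig fg fcvg.
have := @dominated_convergence _ _ _ P setT measurableT f (cst 0%E) g.
case => //.
- apply: filterS fcvg => w fw _.
  apply/fine_cvgP; split.
    near=> m; rewrite ge0_fin_numE//.
    apply: (@le_lt_trans _ _ 1%:E); last exact: ltry.
    by near: m; exact: fw.
  apply/cvgrPdist_le => e e0; near=> m; rewrite sub0r normrN.
  have fm : (f m w <= e%:E)%E by near: m; exact: fw.
  rewrite ger0_norm; last by rewrite fine_ge0.
  rewrite -lee_fin fineK// ge0_fin_numE//.
  exact: le_lt_trans fm (ltry _).
- by apply: filterS fg => w fw m _; rewrite gee0_abs.
by move=> _ _; rewrite integral0.
Unshelve. all: by end_near. Qed.

End limits.

(** * Integrable bound for the moments *)

Section apriori_domination.
Context {R : realType} {d : nat} (U G : 'rV[R]_d -> R).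
Hypothesis (AU : AssumptionU U) (AG : AssumptionG1 G).

(** At a good scale [J] the a priori bound with [M = 2^J] holds for both paths, and the n-th power
    of their distance is at most a constant times the integrable variable. Where that variable is
    infinite there is nothing to show. *)
Lemma moment_domination (dO : measure_display) (Omega : measurableType dO)
    (P : probability Omega R) (W : R -> Omega -> 'rV[R]_d) (q0 p0 : 'rV[R]_d)
    (T : R) (n : nat) :
  std_brownian P W -> q0 != 0 -> 0 < T -> (1 <= n)%N ->
  exists2 e0 : R, 0 < e0 & exists2 Y : Omega -> \bar R, P.-integrable setT Y &
  forall w (eps : R) (q p q' p' : R -> 'rV[R]_d), 0 <= eps <= e0 ->
    path_sol (@langvel R d) (force1 U G) (~` [set 0]) q0 p0 ((W^~ w) \o Num.max 0) q p ->
    path_sol (@relvel R eps d) (force1 U G) (~` [set 0]) q0 p0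
      ((W^~ w) \o Num.max 0) q' p' ->
    forall t, 0 <= t <= T ->
      ((enorm (q' t - q t) ^+ n + enorm (p' t - p t) ^+ n)%:E <= Y w)%E.
Proof.
move=> BW q0n0 T0 n1.
have [dl dl0 [e0 e00 Hap]] := apriori_bound AU AG.
(* Windows have length at most 1, so one that starts by time [T] ends before [H]. *)
pose H := (Num.truncn T).+2.
have TH : T + 1 < H%:R.
  by have /andP[_] := truncn_itv (ltW T0); rewrite /H -[in X in _ -> X]natr1 ltrD2r.
have c0 : 0 < dl / 7 by rewrite divr_gt0.
have [eta eta0 [Y [iY Y0 HY]]] := brownian_osc_domination BW H c0.
have n0 : 0 < n%:R :> R by rewrite ltr0n.
(* The rate is divided by [n] because the bound will be raised to the power [n]. *)
have [C C0 HC] := Hap T (eta / n%:R) q0 p0 T0 (divr_gt0 eta0 n0) q0n0.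
pose K : R := 2 * (2 * C) ^+ n.
have K0 : 0 < K by rewrite mulr_gt0// exprn_gt0// mulr_gt0.
exists e0 => //; exists (fun w => K%:E * Y w)%E; first exact: integrableZl.
move=> w eps q p q' p' eps0 hl hr t tT.
have [->|[J [osc YJ]]] := HY w; first by rewrite gt0_muley ?leey// lte_fin.
pose M : R := 2 ^+ J.
have M1 : 1 <= M by rewrite exprn_ege1// ler1n.
have cW : continuous ((W^~ w) \o Num.max 0).
  by have [_ /(_ w)/continuous_clamp] := BW.
have osc' s u l : 0 <= s <= T -> 0 <= u <= M^-1 ->
    `|((W^~ w) \o Num.max 0) (s + u) 0 l - ((W^~ w) \o Num.max 0) s 0 l| <= dl.
  move=> /andP[s0 sT] uM; have /andP[u0 u1] := uM.
  rewrite /= (max_idPr s0) (max_idPr (addr_ge0 s0 u0)).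
  have -> : dl = 7 * (dl / 7) by field.
  apply: osc => //; apply: le_lt_trans TH; apply: lerD => //.
  by rewrite (le_trans u1)// invf_le1// (lt_le_trans ltr01).
have z0 : 0 <= (0 : R) <= e0 by rewrite lexx ltW.
rewrite -relvel0 in hl.
have b1 := HC 0 M _ _ _ z0 M1 cW hl osc' t tT.
have b2 := HC eps M _ _ _ eps0 M1 cW hr osc' t tT.
apply: (@le_trans _ _ (K%:E * (expR (eta * M))%:E)%E); last first.
  by rewrite lee_pmul2l ?lte_fin.
rewrite -EFinM lee_fin.
set E := expR (eta / n%:R * M) in b1 b2.
have CE0 : 0 <= C * E by rewrite mulr_ge0 ?expR_ge0// ltW.
have -> : K * expR (eta * M) = (2 * (C * E)) ^+ n + (2 * (C * E)) ^+ n.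
  have -> : expR (eta * M) = E ^+ n.
    rewrite /E -expRM_natl; congr expR.
    by field; rewrite gt_eqF.
  by rewrite /K !exprMn; ring.
have nq := enormB (q' t) (q t); have np := enormB (p' t) (p t).
have := enorm_ge0 (q t); have := enorm_ge0 (q' t).
have := enorm_ge0 (p t); have := enorm_ge0 (p' t) => n1' n2' n3' n4'.
have CE2 : 0 <= 2 * (C * E) by rewrite mulr_ge0.
apply: lerD; apply: lerXn2r; rewrite ?nnegrE ?enorm_ge0//.
  by move: nq b1 b2 n1' n2'; clear; lra.
by move: np b1 b2 n3' n4'; clear; lra.
Qed.

End apriori_domination.

Theorem theorem2p6 (R : realType) (d : nat) (U G : 'rV[R]_d -> R) :
  AssumptionU U -> AssumptionG1 G ->
  (* 1. multi-particle, N >= 2: convergence in probability *)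
  (forall (N : nat) (dO : measure_display) (Omega : measurableType dO)
      (P : probability Omega R) (W : R -> Omega -> 'M[R]_(N, d))
      (q0 p0 : 'M[R]_(N, d))
      (qe pe : R -> R -> Omega -> 'M[R]_(N, d))
      (ql pl : R -> Omega -> 'M[R]_(N, d)),
    (2 <= N)%N ->
    std_brownian P W ->
    noncoll q0 ->
    (forall eps : R, 0 < eps < 1 ->
       [/\ good_process (qe eps), good_process (pe eps) &
        {ae P, forall w, is_solution (@relvel R eps d) (forceN U G) (@noncoll R N d)
                 q0 p0 (fun t => W t w) (fun t => qe eps t w)
                 (fun t => pe eps t w)}]) ->
    good_process ql -> good_process pl ->
    {ae P, forall w, is_solution (@langvel R d) (forceN U G) (@noncoll R N d)
             q0 p0 (fun t => W t w) (fun t => ql t w) (fun t => pl t w)} ->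
    forall T xi : R, 0 < T -> 0 < xi ->
      P [set w | (xi%:E < ereal_sup
                   [set (enorm (qe eps t w - ql t w)
                         + enorm (pe eps t w - pl t w))%:E | t in `[0%R, T]])%E]
        @[eps --> 0^'+] --> 0%E)
  /\
  (* 2. single particle, N = 1: convergence of all moments *)
  (forall (dO : measure_display) (Omega : measurableType dO)
      (P : probability Omega R) (W : R -> Omega -> 'rV[R]_d)
      (q0 p0 : 'rV[R]_d)
      (qe pe : R -> R -> Omega -> 'rV[R]_d)
      (ql pl : R -> Omega -> 'rV[R]_d),
    std_brownian P W ->
    q0 != 0 ->
    (forall eps : R, 0 < eps < 1 ->
       [/\ good_process (qe eps), good_process (pe eps) &
        {ae P, forall w, is_solution (@relvel R eps d) (force1 U G) (~` [set 0])
                 q0 p0 (fun t => W t w) (fun t => qe eps t w)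
                 (fun t => pe eps t w)}]) ->
    good_process ql -> good_process pl ->
    {ae P, forall w, is_solution (@langvel R d) (force1 U G) (~` [set 0])
             q0 p0 (fun t => W t w) (fun t => ql t w) (fun t => pl t w)} ->
    forall (T : R) (n : nat), 0 < T -> (1 <= n)%N ->
      (\int[P]_w ereal_sup
          [set (enorm (qe eps t w - ql t w) ^+ n
                + enorm (pe eps t w - pl t w) ^+ n)%:E | t in `[0%R, T]])%E
        @[eps --> 0^'+] --> 0%E).
Proof.
move=> AU AG.
have sU : smooth_on setT U by case: AU.
have sG : smooth_on (~` [set 0]) G by case: AG.
split.
  move=> N dO Omega P W q0 p0 qe pe ql pl _ [W0 _ _] _ rel gql gpl lang T xi T0 xi0.
  apply: (@cvg_at_right0_seq _ _ _ _ 1 ltr01) => u u01 cu.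
  have lF x : @noncoll R N d x -> loclip (forceN U G) x by exact: loclip_forceN.
  have rel' (eps : R) (e01 : 0 < eps < 1) := let: And3 _ _ h := rel eps e01 in h.
  pose X m t w := enorm (qe (u m) t w - ql t w) + enorm (pe (u m) t w - pl t w).
  have mX m : measurable_fun setT (supproc T (X m)).
    have [gq gp _] := rel _ (u01 m).
    apply: measurable_supproc => // [t|w].
      by apply: measurable_funD; exact: measurable_enormB.
    by move=> t; apply: cvgD; exact: continuous_enormB.
  apply: (@cvg_measure_ae_evanescent _ _ _ P (fun m => [set w | (xi%:E < supproc T (X m) w)%E])).
    move=> m; rewrite -[X in measurable X]setTI.
    exact: emeasurable_fun_o_infty.
  have := ae_clamped_sols W0 lF rel' lang u01; apply: filterS => w sol.
  have := clamped_sols_cvg lF T0 xi0 u01 cu sol; apply: filterS => m Xm.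
  apply/negP; rewrite -leNgt; apply: supproc_le => t /Xm.
  by rewrite lee_fin => /ltW.
move=> dO Omega P W q0 p0 qe pe ql pl BW q0n0 rel gql gpl lang T n T0 n1.
have [e0 e00 [Y iY HY]] := moment_domination AU AG p0 BW q0n0 T0 n1.
have W0 : forall w, W 0 w = 0 by case: BW.
have m0 : 0 < Num.min e0 1 by rewrite lt_min e00 ltr01.
apply: (@cvg_at_right0_seq _ _ _ _ _ m0) => u um cu.
have u01 m : 0 < u m < 1.
  by have /andP[-> /lt_le_trans] := um m; apply; rewrite ge_min lexx orbT.
have ue0 m : 0 <= u m <= e0.
  have /andP[/ltW -> /ltW h] := um m.
  by apply: (le_trans h); rewrite ge_min lexx.
have lF x : (~` [set 0]) x -> loclip (force1 U G) x by exact: loclip_force1.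
have rel' (eps : R) (e01 : 0 < eps < 1) := let: And3 _ _ h := rel eps e01 in h.
pose X m t w := enorm (qe (u m) t w - ql t w) ^+ n + enorm (pe (u m) t w - pl t w) ^+ n.
have X0 m t w : 0 <= X m t w by rewrite addr_ge0// exprn_ge0// enorm_ge0.
have aesol := ae_clamped_sols W0 lF rel' lang u01.
apply: (@cvg_integral_dominated0 _ _ _ P (fun m => supproc T (X m)) Y) => //.
- move=> m; have [gq gp _] := rel _ (u01 m).
  apply: measurable_supproc => // [t|w].
    by apply: measurable_funD; apply: measurable_funX; exact: measurable_enormB.
  move=> t.
  have cXn (f : R -> R) : {for t, continuous f} -> {for t, continuous (fun s => f s ^+ n)}.
    by move=> cf; exact: (continuous_comp cf (@exprn_continuous R n _)).
  by apply: cvgD; apply: cXn; exact: continuous_enormB.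
- by move=> m w; exact: supproc_ge0.
- apply: filterS aesol => w [hl hr] m; apply: supproc_le => t tT.
  have /andP[t0 _] := tT.
  by have := HY w (u m) _ _ _ _ (ue0 m) hl (hr m) t tT; rewrite /= (max_idPr t0).
- apply: filterS aesol => w sol e e_gt0.
  (* Distances below 1 dominate their own n-th powers. *)
  have xi0 : 0 < Num.min e 1 by rewrite lt_min e_gt0 ltr01.
  have := clamped_sols_cvg lF T0 xi0 u01 cu sol; apply: filterS => m Xm.
  apply: supproc_le => t /Xm; rewrite lee_fin lt_min => /andP[/ltW h1 /ltW h2].
  apply: le_trans h1.
  have a0 := enorm_ge0 (qe (u m) t w - ql t w).
  have b0 := enorm_ge0 (pe (u m) t w - pl t w).
  by apply: lerD; apply: ler_iXnr => //; apply: le_trans h2; rewrite ?lerDl ?lerDr.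
Qed.
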